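(* Let $R\in(0,+\infty]$, $s_+>0$, $p>0$, $q>0$, and let $F:\mathbb{R}\to\mathbb{R}$ be a $C^1$ function such that $F(0)=F(s_+)=0$, $F'(s_+)>0$, $F(t)<0$ for $t\in(0,s_+)$, and $F(t)\ge 0$ for $t\in(s_+,+\infty)$. Assume in addition that there exists $s_-\in[-s_+,0)$ such that $F(t)\le0$ for $t\in(-\infty,s_-)$, $F(t)\ge0$ for $t\in(s_-,0)$, and $$\frac{F(t_1)}{t_1}+\frac{F(-t_2)}{t_2}\le 0\quad\text{whenever } 0<t_1\le t_2\le|s_-|.$$ Then there exists a unique solution $u$ (no sign condition being imposed on $u$) of the boundary value problem $$u''(r)+\frac{p}{r}u'(r)-\frac{q}{r^2}u(r)=F(u(r))\ \text{ in }(0,R),\qquad u(0)=0,\quad u(R)=s_+.$$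
   Context: A solution is a function $u\in C^2(0,R)$ satisfying the ODE pointwise in $(0,R)$; the boundary conditions mean $\lim_{r\to0^+}u(r)=0$ and $\lim_{r\to R^-}u(r)=s_+$ (limit at $+\infty$ if $R=+\infty$). *)

(* Defs.v *)
From Stdlib Require Import Reals.
From Coquelicot Require Import Coquelicot.
Open Scope R_scope.

Definition is_C1 (F : R -> R) : Prop :=
  forall t, ex_derive F t /\ continuous (Derive F) t.

Definition is_C2_on (u : R -> R) (b : Rbar) : Prop :=
  forall r : R, 0 < r -> Rbar_lt r b ->
    ex_derive u r /\ ex_derive (Derive u) r /\
    continuous (Derive (Derive u)) r.

(* For finite [b] this unfolds to [at_left b]; for [b = p_infty] it is
   convergence to plus infinity. *)
Definition Rbar_at_left (b : Rbar) : (R -> Prop) -> Prop :=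
  within (fun r : R => Rbar_lt r b) (Rbar_locally b).

(* The values of [u] outside the open interval (0, b) are irrelevant: the
   boundary conditions are one-sided limits. *)
Definition is_solution (b : Rbar) (sp p q : R) (F u : R -> R) : Prop :=
  is_C2_on u b /\
  (forall r : R, 0 < r -> Rbar_lt r b ->
     Derive (Derive u) r + p / r * Derive u r - q / r ^ 2 * u r = F (u r)) /\
  filterlim u (at_right 0) (locally 0) /\
  filterlim u (Rbar_at_left b) (locally sp).

(* Main.v *)
Require Import Defs.
From Stdlib Require Import Reals Lra Lia Classical.
From Coquelicot Require Import Coquelicot.
Open Scope R_scope.

(** Uniqueness.  As long as |u| <= m, the energy
    u'^2/2 - Phi(u) + q (m^2 - u^2) / (2 r^2), where Phi' = F, is nonincreasing.  Hence
    after a critical point of height |u| = m the solution cannot climb back to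
    m <= s_+ unless Phi(m) exceeds Phi(u).  At a negative minimum -m, the
    hypothesis on F with t1 = t2 gives Phi(m) <= Phi(-m), so every solution is
    nonnegative; at a positive local maximum this makes it nondecreasing.  For two
    such solutions u, v and la >= 1, u(la r) is a supersolution because F <= 0 on
    [0, s_+]; decreasing la from large values, a first contact with v at some
    la > 1 is impossible, so v <= u, and equality follows by symmetry.

    Existence.  After truncation of F outside [0, s_+], for every c there is a
    solution behaving like c r^al at 0, where al is the positive indicial root,
    and it depends continuously on c.  For finite R the intermediate value
    theorem in c yields u(R) = s_+.  For R infinite, take the infimum of the c
    whose solution exceeds s_+: it is positive by the energy estimate, and its
    solution is nondecreasing with limit a positive zero of F. *)

(** * Limits, maxima and crossings on (0, b) *)

(** Since F is not monotone on [0, s_+], the difference of two solutions obeys no maximum principle.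
    Rescaling replaces it: the linear part is homogeneous of degree -2, so u(la r) solves the same
    equation with F multiplied by la^2, and F < 0 gives a sign that is strict for la > 1. What
    threatens this sliding argument is loss of compactness, a contact escaping to 0 or to the end of
    the interval; the term q / r^2 prevents the former, F'(s_+) > 0 the latter. The singularity at 0
    rules out ordinary initial data, so the shooting parameter is the amplitude c of r^al, and the
    factor w = u / r^al solves an integral equation that is regular at 0. The truncated F is
    globally Lipschitz, so all shots are global, and it vanishes outside [0, s_+], so a shot that
    leaves this range never returns. Exceeding s_+ is therefore an open condition on c that persists
    in r; on the half-line the critical shot is not among the exceeding ones and inherits its sign
    and monotonicity from them as a limit. *)

Definition dom (b : Rbar) (r : R) : Prop := 0 < r /\ Rbar_lt r b.

Definition tends_at_zero (u : R -> R) : Prop :=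
  forall eps, 0 < eps ->
    exists d, 0 < d /\ forall r, 0 < r < d -> Rabs (u r) < eps.

(** The threshold is a point of the interval rather than a distance to [b], so that one formula
    serves a finite end and infinity. *)
Definition tends_at_end (b : Rbar) (u : R -> R) (l : R) : Prop :=
  forall eps, 0 < eps ->
    exists c, dom b c /\
      forall r, c < r -> Rbar_lt r b -> Rabs (u r - l) < eps.

Lemma dom_le (b : Rbar) (x y : R) : 0 < x <= y -> dom b y -> dom b x.
Proof.
intros [hx hxy] [_ hy]; split; [exact hx|].
exact (Rbar_le_lt_trans x y b hxy hy).
Qed.

Lemma dom_finite (b x : R) : dom b x <-> 0 < x < b.
Proof. unfold dom; simpl; tauto. Qed.

Lemma dom_locally (b : Rbar) (r : R) : dom b r ->
  exists d, 0 < d /\ forall y, Rabs (y - r) < d -> dom b y.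
Proof.
intros [h0 hb]; destruct b as [b| |]; simpl in hb; try easy.
- exists (Rmin r (b - r)); split; [apply Rmin_pos; lra|].
  intros y hy; apply dom_finite.
  pose proof (Rmin_l r (b - r)); pose proof (Rmin_r r (b - r)).
  apply Rabs_def2 in hy; lra.
- exists r; split; [exact h0|].
  intros y hy; apply Rabs_def2 in hy; split; simpl; [lra|easy].
Qed.

Lemma dom_above (b : Rbar) (r : R) : dom b r -> exists r', r < r' /\ dom b r'.
Proof.
intros h; destruct (dom_locally b r h) as [d [hd H]].
exists (r + d / 2); split; [lra|].
apply H; rewrite Rabs_pos_eq; lra.
Qed.

Lemma dom_lt_end (b : Rbar) (r : R) : dom b r ->
  Rbar_at_left b (fun x => r < x).
Proof.
intros [h0 hb]; unfold Rbar_at_left, within.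
destruct b as [b| |]; simpl in *; try easy.
- assert (hd : 0 < b - r) by lra.
  exists (mkposreal _ hd); intros y hy hyb.
  apply Rabs_def2 in hy; unfold minus, plus, opp in hy; simpl in hy; lra.
- exists r; intros x hx _; exact hx.
Qed.

Lemma tends_at_zero_filterlim (u : R -> R) :
  tends_at_zero u <-> filterlim u (at_right 0) (locally 0).
Proof.
split.
- intros h; apply filterlim_locally; intros eps.
  destruct (h eps (cond_pos eps)) as [d [hd H]].
  exists (mkposreal d hd); intros y hy hy0.
  apply Rabs_def2 in hy; unfold minus, plus, opp in hy; simpl in hy.
  change (Rabs (u y - 0) < eps); rewrite Rminus_0_r; apply H; lra.
- intros h eps heps.
  apply filterlim_locally with (eps := mkposreal eps heps) in h.
  destruct h as [d H]; exists d; split; [apply cond_pos|].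
  intros r hr; specialize (H r).
  rewrite <- (Rminus_0_r (u r)); apply H; [|lra].
  change (Rabs (r - 0) < d); rewrite Rminus_0_r, Rabs_pos_eq; lra.
Qed.

Lemma tends_at_end_filterlim (b : Rbar) (u : R -> R) (l : R) : Rbar_lt 0 b ->
  (tends_at_end b u l <-> filterlim u (Rbar_at_left b) (locally l)).
Proof.
intros hb; split.
- intros h; apply filterlim_locally; intros eps.
  destruct (h eps (cond_pos eps)) as [c [hc H]].
  assert (hle := dom_lt_end b c hc); revert hle.
  unfold Rbar_at_left, within.
  apply filter_imp; intros x hx hxb; exact (H x (hx hxb) hxb).
- intros h eps heps.
  apply filterlim_locally with (eps := mkposreal eps heps) in h.
  unfold Rbar_at_left, within in h.
  destruct b as [b| |]; simpl in *; try easy.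
  + destruct h as [d H].
    assert (hm1 := Rmax_l (b / 2) (b - d)); assert (hm2 := Rmax_r (b / 2) (b - d)).
    assert (hd := cond_pos d).
    exists (Rmax (b / 2) (b - d)); split.
    * apply dom_finite; split; [lra|]; apply Rmax_lub_lt; lra.
    * intros r hr hrb; apply (H r); [|exact hrb].
      change (Rabs (r - b) < d); apply Rabs_def1; lra.
  + destruct h as [M H].
    exists (Rmax M 1); assert (hm1 := Rmax_l M 1); assert (hm2 := Rmax_r M 1).
    split; [split; simpl; [lra|easy]|].
    intros r hr _; apply (H r); [lra|easy].
Qed.

Lemma continuous_eps (f : R -> R) (x : R) :
  continuous f x <->
  forall eps, 0 < eps ->
    exists d, 0 < d /\ forall y, Rabs (y - x) < d -> Rabs (f y - f x) < eps.
Proof.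
split.
- intros h eps heps.
  apply filterlim_locally with (eps := mkposreal eps heps) in h.
  destruct h as [d H]; exists d; split; [apply cond_pos|]; exact H.
- intros h; apply filterlim_locally; intros eps.
  destruct (h eps (cond_pos eps)) as [d [hd H]].
  exists (mkposreal d hd); exact H.
Qed.

Lemma continuous_continuity_pt (f : R -> R) (x : R) :
  continuous f x <-> continuity_pt f x.
Proof. symmetry; apply continuity_pt_filterlim. Qed.

Lemma is_derive_continuous (f : R -> R) (x l : R) :
  is_derive f x l -> continuous f x.
Proof. intros h; apply (ex_derive_continuous f); exists l; exact h. Qed.

Lemma tends_at_end_finite (b : R) (u : R -> R) : 0 < b ->
  continuous u b -> tends_at_end b u (u b).
Proof.
intros hb hu eps heps.
destruct (proj1 (continuous_eps u b) hu eps heps) as [d [hd H]].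
assert (hm1 := Rmax_l (b / 2) (b - d)); assert (hm2 := Rmax_r (b / 2) (b - d)).
exists (Rmax (b / 2) (b - d)); split.
- apply dom_finite; split; [lra|]; apply Rmax_lub_lt; lra.
- intros r hr hrb; simpl in hrb; apply H; apply Rabs_def1; lra.
Qed.

(** * Mean value inequalities, interior maxima, first crossings *)

Lemma mean_value (f df : R -> R) (x y : R) : x < y ->
  (forall r, x <= r <= y -> is_derive f r (df r)) ->
  exists c, x < c < y /\ f y - f x = df c * (y - x).
Proof.
intros hxy h.
destruct (MVT_cor2 f df x y hxy) as [c [h1 h2]].
- intros c hc; apply is_derive_Reals; auto.
- exists c; auto.
Qed.

Lemma derive_nonpos_le (f df : R -> R) (x y : R) : x <= y ->
  (forall r, x <= r <= y -> is_derive f r (df r)) ->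
  (forall r, x <= r <= y -> df r <= 0) -> f y <= f x.
Proof.
intros [hxy| ->] h1 h2; [|lra].
destruct (mean_value f df x y hxy h1) as [c [hc E]].
assert (df c <= 0) by (apply h2; lra); nra.
Qed.

Lemma derive_dominated (f g df dg : R -> R) (x y : R) : x <= y ->
  (forall r, x <= r <= y -> is_derive f r (df r)) ->
  (forall r, x <= r <= y -> is_derive g r (dg r)) ->
  (forall r, x <= r <= y -> Rabs (df r) <= dg r) ->
  Rabs (f y - f x) <= g y - g x.
Proof.
intros hxy hf hg h.
assert (h1 : f y - g y <= f x - g x).
{ apply (derive_nonpos_le (fun r => f r - g r) (fun r => df r - dg r)); auto.
  - intros r hr; apply (is_derive_minus (V := R_NormedModule)); auto.
  - intros r hr; specialize (h r hr); apply Rabs_le_between in h; lra. }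
assert (h2 : - f y - g y <= - f x - g x).
{ apply (derive_nonpos_le (fun r => - f r - g r) (fun r => - df r - dg r)); auto.
  - intros r hr; apply (is_derive_minus (V := R_NormedModule)); auto.
    apply (is_derive_opp (V := R_NormedModule)); auto.
  - intros r hr; specialize (h r hr); apply Rabs_le_between in h; lra. }
apply Rabs_le; lra.
Qed.

Lemma derive_pos_right (f : R -> R) (x y d : R) : x < y ->
  is_derive f x d -> 0 < d -> exists z, x < z < y /\ forall t, x < t <= z -> f x < f t.
Proof.
intros hxy h hd; apply is_derive_Reals in h.
destruct (h d hd) as [e H].
assert (he := cond_pos e).
assert (hm1 := Rmin_l (e / 2) ((y - x) / 2)).
assert (hm2 := Rmin_r (e / 2) ((y - x) / 2)).
assert (hm : 0 < Rmin (e / 2) ((y - x) / 2)) by (apply Rmin_pos; lra).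
exists (x + Rmin (e / 2) ((y - x) / 2)); split; [lra|].
intros t ht; assert (ht0 : t - x <> 0) by lra.
assert (hte : Rabs (t - x) < e) by (rewrite Rabs_pos_eq; lra).
specialize (H (t - x) ht0 hte); apply Rabs_def2 in H.
replace (x + (t - x)) with t in H by ring.
assert (h0 : 0 < (f t - f x) / (t - x)) by lra.
assert (h1 : 0 < (f t - f x) / (t - x) * (t - x)) by (apply Rmult_lt_0_compat; lra).
replace ((f t - f x) / (t - x) * (t - x)) with (f t - f x) in h1 by (field; lra).
lra.
Qed.

(** If [d] were positive, [f1] would be positive just to the right of its zero [r0], and the mean
    value theorem would push [f] above its maximum. *)
Lemma max_derivatives (b : Rbar) (f f1 : R -> R) (r0 d : R) :
  (forall r, dom b r -> is_derive f r (f1 r)) ->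
  dom b r0 -> is_derive f1 r0 d ->
  (forall r, dom b r -> f r <= f r0) ->
  f1 r0 = 0 /\ d <= 0.
Proof.
intros hf hr0 hd hmax.
destruct (dom_locally b r0 hr0) as [e [he hdom]].
assert (hfr := hf r0 hr0).
assert (h0 : f1 r0 = 0).
{ destruct (Rtotal_order (f1 r0) 0) as [h|[h|h]]; [exfalso|exact h|exfalso].
  (* Reflection t -> -t turns a negative derivative into an increase to the right. *)
  - assert (hneg : is_derive (fun t => f (- t)) (- r0) (- f1 r0)).
    { replace (- f1 r0) with (-1 * f1 r0) by ring.
      apply (is_derive_comp (V := R_NormedModule) f (fun t => - t)).
      - rewrite Ropp_involutive; exact hfr.
      - auto_derive; [easy|ring]. }
    destruct (derive_pos_right (fun t => f (- t)) (- r0) (- r0 + e) (- f1 r0) ltac:(lra) hneg ltac:(lra))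
      as [z [hz H]].
    specialize (H z ltac:(lra)); rewrite Ropp_involutive in H.
    assert (f (- z) <= f r0); [apply hmax, hdom, Rabs_def1; lra|lra].
  - destruct (derive_pos_right f r0 (r0 + e) (f1 r0) ltac:(lra) hfr h) as [z [hz H]].
    specialize (H z ltac:(lra)).
    assert (f z <= f r0); [apply hmax, hdom, Rabs_def1; lra|lra]. }
split; [exact h0|].
apply Rnot_lt_le; intros hpos.
destruct (derive_pos_right f1 r0 (r0 + e) d ltac:(lra) hd hpos) as [z [hz H]].
destruct (mean_value f f1 r0 z) as [c [hc E]]; [lra| |].
- intros r hr; apply hf, hdom, Rabs_def1; lra.
- specialize (H c ltac:(lra)); rewrite h0 in H.
  assert (f z <= f r0); [apply hmax, hdom, Rabs_def1; lra|nra].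
Qed.

(** Near both ends [f] stays below its value at [x0], so the maximum over a compact interval
    containing [x0] is global. *)
Lemma interior_max (b : Rbar) (f : R -> R) (x0 : R) :
  (forall r, dom b r -> continuous f r) -> dom b x0 ->
  (exists a, 0 < a /\ forall r, 0 < r < a -> f r <= f x0) ->
  (exists c, dom b c /\ forall r, c < r -> Rbar_lt r b -> f r <= f x0) ->
  exists r0, dom b r0 /\ forall r, dom b r -> f r <= f r0.
Proof.
intros hf hx0 [a [ha Ha]] [c [hc Hc]].
set (A := Rmin (a / 2) x0); set (C := Rmax c x0).
assert (hx0' := proj1 hx0).
assert (hA1 : A <= a / 2) by apply Rmin_l; assert (hA2 : A <= x0) by apply Rmin_r.
assert (hA : 0 < A) by (apply Rmin_pos; lra).
assert (hC1 : c <= C) by apply Rmax_l; assert (hC2 : x0 <= C) by apply Rmax_r.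
assert (hC : dom b C) by (unfold C, Rmax; destruct (Rle_dec c x0); auto).
destruct (continuity_ab_maj f A C) as [M [HM hM]]; [lra| |].
- intros r hr; apply continuous_continuity_pt, hf, (dom_le b r C); [lra|exact hC].
- assert (hx : f x0 <= f M) by (apply HM; lra).
  exists M; split; [apply (dom_le b M C); [lra|exact hC]|].
  intros r hr; assert (hr0 := proj1 hr).
  destruct (Rlt_le_dec r A) as [h1|h1]; [specialize (Ha r ltac:(lra)); lra|].
  destruct (Rle_lt_dec r C) as [h2|h2]; [apply HM; lra|].
  specialize (Hc r ltac:(lra) (proj2 hr)); lra.
Qed.

Lemma interior_max_of_limits (b : Rbar) (f : R -> R) (x0 l : R) :
  (forall r, dom b r -> continuous f r) -> dom b x0 ->
  tends_at_zero f -> tends_at_end b f l -> 0 < f x0 -> l < f x0 ->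
  exists r0, dom b r0 /\ forall r, dom b r -> f r <= f r0.
Proof.
intros hf hx0 h0 hl hp hlp; apply (interior_max b f x0); auto.
- destruct (h0 (f x0) hp) as [d [hd H]]; exists d; split; [exact hd|].
  intros r hr; specialize (H r hr); apply Rabs_def2 in H; lra.
- destruct (hl (f x0 - l) ltac:(lra)) as [c [hc H]]; exists c; split; [exact hc|].
  intros r hr hrb; specialize (H r hr hrb); apply Rabs_def2 in H; lra.
Qed.

(** [c] is the supremum of the points up to which [f] stays at most [m]; continuity on both sides
    makes the value there exactly [m]. *)
Lemma first_crossing (f : R -> R) (x y m : R) : x <= y ->
  (forall r, x <= r <= y -> continuous f r) -> f x <= m -> m < f y ->
  exists c, x <= c < y /\ f c = m /\ forall r, x <= r <= c -> f r <= m.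
Proof.
intros hxy hf hx hy.
set (E := fun c => x <= c <= y /\ forall r, x <= r <= c -> f r <= m).
assert (hEx : E x).
{ split; [lra|]; intros r hr; replace r with x by lra; exact hx. }
destruct (completeness E) as [c [hc1 hc2]].
{ exists y; intros c [hc _]; lra. }
{ exists x; exact hEx. }
assert (hxc : x <= c) by (apply hc1, hEx).
assert (hcy : c <= y) by (apply hc2; intros z [hz _]; lra).
assert (hlt : forall r, x <= r < c -> f r <= m).
{ intros r hr; apply Rnot_lt_le; intros h.
  assert (hr' : c <= r); [|lra].
  apply hc2; intros z [hz Hz]; apply Rnot_lt_le; intros hrz.
  specialize (Hz r ltac:(lra)); lra. }
assert (hcont := proj1 (continuous_eps f c) (hf c ltac:(lra))).
assert (hcm : f c <= m).
{ apply Rnot_lt_le; intros h.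
  destruct hxc as [hxc|hxc]; [|rewrite <- hxc in h; lra].
  destruct (hcont (f c - m) ltac:(lra)) as [d [hd H]].
  assert (h1 := Rmax_l x (c - d / 2)); assert (h2 := Rmax_r x (c - d / 2)).
  assert (h3 : Rmax x (c - d / 2) < c) by (apply Rmax_lub_lt; lra).
  specialize (H (Rmax x (c - d / 2)) ltac:(apply Rabs_def1; lra)).
  specialize (hlt (Rmax x (c - d / 2)) ltac:(lra)).
  apply Rabs_def2 in H; lra. }
assert (hcy' : c < y) by (destruct hcy as [h| ->]; [exact h|lra]).
exists c; split; [lra|]; split.
- apply Rle_antisym; [exact hcm|]; apply Rnot_lt_le; intros h.
  destruct (hcont (m - f c) ltac:(lra)) as [d [hd H]].
  assert (h1 := Rmin_l y (c + d / 2)); assert (h2 := Rmin_r y (c + d / 2)).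
  assert (h3 : c < Rmin y (c + d / 2)) by (apply Rmin_glb_lt; lra).
  assert (hE : E (Rmin y (c + d / 2))).
  { split; [lra|]; intros r hr.
    destruct (Rlt_le_dec r c) as [h4|h4]; [apply hlt; lra|].
    specialize (H r ltac:(apply Rabs_def1; lra)); apply Rabs_def2 in H; lra. }
  specialize (hc1 _ hE); lra.
- intros r hr; destruct (Req_dec r c) as [-> |h]; [exact hcm|apply hlt; lra].
Qed.

(** * Maximum principle and energy *)

(** The nonlinearity is a parameter because the same equation is used with F, its truncation, its
    reflection -F(-t) and its multiples by la^2. *)
Definition ode (p q : R) (f : R -> R) (b : Rbar) (u u1 : R -> R) : Prop :=
  forall r, dom b r ->
    is_derive u r (u1 r) /\
    is_derive u1 r (f (u r) - p / r * u1 r + q / r ^ 2 * u r).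

Lemma ode_of_solution (b : Rbar) (sp p q : R) (F u : R -> R) :
  is_solution b sp p q F u -> ode p q F b u (Derive u).
Proof.
intros [h1 [h2 _]] r [hr hb].
destruct (h1 r hr hb) as [hu [hu1 _]]; split.
- apply Derive_correct; exact hu.
- replace (F (u r) - p / r * Derive u r + q / r ^ 2 * u r)
    with (Derive (Derive u) r) by (rewrite <- (h2 r hr hb); ring).
  apply Derive_correct; exact hu1.
Qed.

Lemma ode_continuous (p q : R) (f : R -> R) (b : Rbar) (u u1 : R -> R) (r : R) :
  ode p q f b u u1 -> dom b r -> continuous u r.
Proof. intros h hr; exact (is_derive_continuous u r _ (proj1 (h r hr))). Qed.

(** The C^2 regularity comes from the equation itself: near each point the second derivative
    coincides with the continuous right-hand side [u2]. *)
Lemma solution_of_ode (b : Rbar) (sp p q : R) (F u u1 : R -> R) :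
  Rbar_lt 0 b -> (forall t, continuous F t) -> ode p q F b u u1 ->
  tends_at_zero u -> tends_at_end b u sp -> is_solution b sp p q F u.
Proof.
intros hb hF h h0 hl.
set (u2 := fun r => F (u r) - p / r * u1 r + q / r ^ 2 * u r).
assert (hD : forall r, dom b r -> locally r (fun t => u1 t = Derive u t)).
{ intros r hr; destruct (dom_locally b r hr) as [d [hd H]].
  exists (mkposreal d hd); intros y hy; symmetry.
  apply is_derive_unique, h, H; exact hy. }
assert (hD2 : forall r, dom b r -> is_derive (Derive u) r (u2 r)).
{ intros r hr; apply (is_derive_ext_loc u1); [exact (hD r hr)|apply h, hr]. }
split; [|split; [|split]].
- intros r hr hrb; assert (hd : dom b r) by (split; assumption).
  split; [exists (u1 r); apply h, hd|].
  split; [exists (u2 r); apply hD2, hd|].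
  apply (continuous_ext_loc _ u2).
  { destruct (dom_locally b r hd) as [d [hpos H]].
    exists (mkposreal d hpos); intros y hy; symmetry.
    apply is_derive_unique, hD2, H; exact hy. }
  destruct (h r hd) as [hu hu1].
  assert (hinv : ex_derive (fun r => p / r) r) by (auto_derive; lra).
  assert (hinv2 : ex_derive (fun r => q / r ^ 2) r).
  { auto_derive; intros hz; apply (pow_nonzero r 2); lra. }
  apply ex_derive_continuous in hinv; apply ex_derive_continuous in hinv2.
  apply (continuous_plus (V := R_NormedModule)); [apply (continuous_minus (V := R_NormedModule))|].
  + apply continuous_comp; [exact (is_derive_continuous u r _ hu)|apply hF].
  + apply (continuous_mult (K := R_AbsRing)); [exact hinv|exact (is_derive_continuous u1 r _ hu1)].
  + apply (continuous_mult (K := R_AbsRing)); [exact hinv2|exact (is_derive_continuous u r _ hu)].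
- intros r hr hrb; assert (hd : dom b r) by (split; assumption).
  rewrite (is_derive_unique _ _ _ (hD2 r hd)), (is_derive_unique _ _ _ (proj1 (h r hd))).
  unfold u2; ring.
- apply tends_at_zero_filterlim, h0.
- apply tends_at_end_filterlim; assumption.
Qed.

Lemma ode_opp (p q : R) (f : R -> R) (b : Rbar) (u u1 : R -> R) :
  ode p q f b u u1 ->
  ode p q (fun t => - f (- t)) b (fun r => - u r) (fun r => - u1 r).
Proof.
intros h r hr; destruct (h r hr) as [h1 h2]; split.
- apply (is_derive_opp (V := R_NormedModule)); exact h1.
- replace (- f (- - u r) - p / r * - u1 r + q / r ^ 2 * - u r)
    with (- (f (u r) - p / r * u1 r + q / r ^ 2 * u r))
    by (rewrite Ropp_involutive; ring).
  apply (is_derive_opp (V := R_NormedModule)); exact h2.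
Qed.

Lemma ode_restrict (p q : R) (f : R -> R) (b b' : Rbar) (u u1 : R -> R) :
  Rbar_le b' b -> ode p q f b u u1 -> ode p q f b' u u1.
Proof.
intros hle h r [h0 hr]; apply h; split; [exact h0|].
exact (Rbar_lt_le_trans r b' b hr hle).
Qed.

Lemma inv_sq_pos (q r : R) : 0 < q -> 0 < r -> 0 < q / r ^ 2.
Proof. intros hq hr; apply Rdiv_lt_0_compat; [exact hq|apply pow_lt, hr]. Qed.

(** At an interior maximum above [s] one has u' = 0, and the equation gives u'' >= q u / r^2 > 0. *)
Lemma maximum_principle (p q : R) (f : R -> R) (b : Rbar) (u u1 : R -> R) (s l : R) :
  0 < q -> ode p q f b u u1 -> tends_at_zero u -> tends_at_end b u l ->
  0 <= s -> l <= s -> (forall t, s < t -> 0 <= f t) ->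
  forall r, dom b r -> u r <= s.
Proof.
intros hq h h0 hl hs hls hf r hr; apply Rnot_lt_le; intros hlt.
destruct (interior_max_of_limits b u r l) as [r0 [hr0 hmax]]; auto; try lra.
{ intros x hx; exact (ode_continuous p q f b u u1 x h hx). }
destruct (max_derivatives b u u1 r0 (f (u r0) - p / r0 * u1 r0 + q / r0 ^ 2 * u r0))
  as [e1 e2]; auto; try (intros; apply h; assumption).
rewrite e1 in e2.
assert (hu : s < u r0) by (specialize (hmax r hr); lra).
assert (h1 := hf (u r0) hu); assert (h2 := inv_sq_pos q r0 hq (proj1 hr0)).
assert (0 < q / r0 ^ 2 * u r0) by (apply Rmult_lt_0_compat; lra).
lra.
Qed.

Lemma minimum_principle (p q : R) (f : R -> R) (b : Rbar) (u u1 : R -> R) (s l : R) :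
  0 < q -> ode p q f b u u1 -> tends_at_zero u -> tends_at_end b u l ->
  s <= 0 -> s <= l -> (forall t, t < s -> f t <= 0) ->
  forall r, dom b r -> s <= u r.
Proof.
intros hq h h0 hl hs hsl hf r hr.
enough (- u r <= - s) by lra.
apply (maximum_principle p q (fun t => - f (- t)) b (fun r => - u r) (fun r => - u1 r) (- s) (- l));
  auto; try lra.
- apply ode_opp, h.
- intros eps heps; destruct (h0 eps heps) as [d [hd H]]; exists d; split; auto.
  intros x hx; rewrite Rabs_Ropp; auto.
- intros eps heps; destruct (hl eps heps) as [c [hc H]]; exists c; split; auto.
  intros x hx hxb; replace (- u x - - l) with (- (u x - l)) by ring.
  rewrite Rabs_Ropp; auto.
- intros t ht; specialize (hf (- t) ltac:(lra)); lra.
Qed.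

(** * The energy and its dissipation *)

Lemma is_derive_primitive (f : R -> R) (t : R) :
  (forall t, continuous f t) -> is_derive (RInt f 0) t (f t).
Proof.
intros hf; apply (is_derive_RInt f (RInt f 0) 0 t); [|apply hf].
apply filter_forall; intros x; apply (RInt_correct (V := R_CompleteNormedModule)).
apply (ex_RInt_continuous (V := R_CompleteNormedModule)); intros; apply hf.
Qed.

(* The last term compensates the only production term in the derivative of the
   natural energy u'^2/2 - Phi(u) - q u^2/(2 r^2), as long as |u| <= m. *)
Definition energy (q m : R) (f u u1 : R -> R) (r : R) : R :=
  u1 r ^ 2 / 2 - RInt f 0 (u r) + q * (m ^ 2 - u r ^ 2) / (2 * r ^ 2).

Lemma is_derive_energy (p q m : R) (f : R -> R) (b : Rbar) (u u1 : R -> R) (r : R) :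
  (forall t, continuous f t) -> ode p q f b u u1 -> dom b r ->
  is_derive (energy q m f u u1) r
    (- (p / r * u1 r ^ 2) - q * (m ^ 2 - u r ^ 2) / r ^ 3).
Proof.
intros hf h hr; destruct (h r hr) as [h1 h2]; assert (hr0 := proj1 hr).
assert (hP : is_derive (fun r => RInt f 0 (u r)) r (u1 r * f (u r))).
{ apply (is_derive_comp (V := R_NormedModule) (RInt f 0) u); [|exact h1].
  apply is_derive_primitive, hf. }
unfold energy.
(* Grouped by the summands of the energy: the terms in f(u) u' cancel, and q u u' / r^2 cancels
   against the derivative of u^2 in the last summand. *)
replace (- (p / r * u1 r ^ 2) - q * (m ^ 2 - u r ^ 2) / r ^ 3) with
  ((f (u r) - p / r * u1 r + q / r ^ 2 * u r) * u1 r - u1 r * f (u r)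
   + (- q * u r * u1 r / r ^ 2 - q * (m ^ 2 - u r ^ 2) / r ^ 3))
  by (field; lra).
apply (is_derive_plus (V := R_NormedModule)).
- apply (is_derive_minus (V := R_NormedModule)); [|exact hP].
  auto_derive; [exists (f (u r) - p / r * u1 r + q / r ^ 2 * u r); exact h2|].
  change (Derive (fun x : R => u1 x) r) with (Derive u1 r).
  rewrite (is_derive_unique _ _ _ h2); field; lra.
- auto_derive.
  + split; [exists (u1 r); exact h1|].
    split; [|easy].
    intros hz; apply (pow_nonzero r 2); [lra|]; simpl; lra.
  + change (Derive (fun x : R => u x) r) with (Derive u r).
    rewrite (is_derive_unique _ _ _ h1); field; lra.
Qed.

Lemma Rabs_le_sq (x m : R) : Rabs x <= m -> 0 <= m ^ 2 - x ^ 2.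
Proof. intros h; apply Rabs_le_between in h; nra. Qed.

(** The middle term keeps the friction p y^2 / r, from which the strict decrease of the energy is
    drawn. *)
Lemma energy_dissipation_nonpos (p q m r x y : R) : 0 < p -> 0 < q -> 0 < r ->
  Rabs x <= m -> - (p / r * y ^ 2) - q * (m ^ 2 - x ^ 2) / r ^ 3 <= - (p / r * y ^ 2) <= 0.
Proof.
intros hp hq hr hx; apply Rabs_le_sq in hx.
assert (h1 : 0 < p / r) by (apply Rdiv_lt_0_compat; lra).
assert (h2 : 0 < r ^ 3) by (apply pow_lt, hr).
assert (h3 : 0 <= q * (m ^ 2 - x ^ 2) / r ^ 3).
{ apply Rmult_le_pos; [apply Rmult_le_pos; lra|left; apply Rinv_0_lt_compat, h2]. }
assert (h4 : 0 <= p / r * y ^ 2) by (apply Rmult_le_pos; [lra|apply pow2_ge_0]).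
lra.
Qed.

Lemma energy_decreasing (p q m : R) (f : R -> R) (b : Rbar) (u u1 : R -> R) (r1 r2 : R) :
  0 < p -> 0 < q -> (forall t, continuous f t) -> ode p q f b u u1 ->
  0 < r1 <= r2 -> dom b r2 -> (forall r, r1 <= r <= r2 -> Rabs (u r) <= m) ->
  energy q m f u u1 r2 <= energy q m f u u1 r1.
Proof.
intros hp hq hf h h12 hr2 hm.
apply (derive_nonpos_le _ (fun r => - (p / r * u1 r ^ 2) - q * (m ^ 2 - u r ^ 2) / r ^ 3)); [lra| |].
- intros r hr; apply (is_derive_energy p q m f b); auto.
  apply (dom_le b r r2); [lra|exact hr2].
- intros r hr.
  destruct (energy_dissipation_nonpos p q m r (u r) (u1 r)) as [a1 a2]; auto; lra.
Qed.

(** Different end values force u' to be nonzero at some interior [c]; the friction there makes the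
    energy drop strictly just after [c]. *)
Lemma energy_strictly_decreasing (p q m : R) (f : R -> R) (b : Rbar) (u u1 : R -> R) (r1 r2 : R) :
  0 < p -> 0 < q -> (forall t, continuous f t) -> ode p q f b u u1 ->
  0 < r1 < r2 -> dom b r2 -> (forall r, r1 <= r <= r2 -> Rabs (u r) <= m) ->
  u r1 <> u r2 ->
  energy q m f u u1 r2 < energy q m f u u1 r1.
Proof.
intros hp hq hf h h12 hr2 hm hne.
assert (hdom : forall r, r1 <= r <= r2 -> dom b r).
{ intros r hr; apply (dom_le b r r2); [lra|exact hr2]. }
destruct (mean_value u u1 r1 r2) as [c [hc E]]; [lra| |].
{ intros r hr; apply h, hdom, hr. }
assert (hu1 : u1 c <> 0) by (intros hz; rewrite hz in E; lra).
assert (hd := is_derive_energy p q m f b u u1 c hf h (hdom c ltac:(lra))).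
apply (is_derive_opp (V := R_NormedModule)) in hd.
destruct (energy_dissipation_nonpos p q m c (u c) (u1 c)) as [a1 _]; auto; try lra.
{ apply hm; lra. }
assert (hneg : 0 < p / c * u1 c ^ 2).
{ apply Rmult_lt_0_compat; [apply Rdiv_lt_0_compat; lra|].
  rewrite <- Rsqr_pow2; apply Rlt_0_sqr, hu1. }
destruct (derive_pos_right _ c r2 _ ltac:(lra) hd) as [z [hz H]].
{ unfold opp; simpl; simpl in a1, hneg; lra. }
specialize (H z ltac:(lra)); unfold opp in H; simpl in H.
assert (energy q m f u u1 c <= energy q m f u u1 r1).
{ apply (energy_decreasing p q m f b); auto; try lra; [apply hdom; lra|].
  intros r hr; apply hm; lra. }
assert (energy q m f u u1 r2 <= energy q m f u u1 z).
{ apply (energy_decreasing p q m f b); auto; try lra.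
  intros r hr; apply hm; lra. }
lra.
Qed.

(** Either u passes [m], and its first crossing serves, or it stays below [m] while tending to s >=
    m. The tolerance is for the second case, where the level may be reached only in the limit. *)
Lemma approach_level (b : Rbar) (u : R -> R) (s m x eps : R) :
  (forall r, dom b r -> continuous u r) -> tends_at_end b u s -> dom b x ->
  u x <= m <= s -> 0 < eps ->
  exists r, x <= r /\ dom b r /\ (forall y, x <= y <= r -> u y <= m) /\
    Rabs (u r - m) < eps.
Proof.
intros hu hs hx hm heps.
destruct (classic (exists y, x <= y /\ dom b y /\ m < u y)) as [[y [hxy [hy hmy]]]|hno].
- destruct (first_crossing u x y m) as [c [hc [hcm hle]]]; try lra.
  { intros r hr; apply hu, (dom_le b r y); [destruct hx; lra|exact hy]. }
  exists c; split; [lra|]; split.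
  { apply (dom_le b c y); [destruct hx; lra|exact hy]. }
  split; [exact hle|]; rewrite hcm, Rminus_diag, Rabs_R0; exact heps.
- assert (hall : forall y, x <= y -> dom b y -> u y <= m).
  { intros y hxy hy; apply Rnot_lt_le; intros h; apply hno; exists y; auto. }
  destruct (hs eps heps) as [c [hc H]].
  assert (hC : dom b (Rmax c x)) by (unfold Rmax; destruct (Rle_dec c x); auto).
  destruct (dom_above b _ hC) as [r [hr hdr]].
  assert (h1 := Rmax_l c x); assert (h2 := Rmax_r c x).
  specialize (H r ltac:(lra) (proj2 hdr)).
  exists r; split; [lra|]; split; [exact hdr|]; split.
  { intros y hy; apply hall; [lra|]; apply (dom_le b y r); [destruct hx; lra|exact hdr]. }
  specialize (hall r ltac:(lra) hdr); apply Rabs_def2 in H; apply Rabs_def1; lra.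
Qed.

(* Once |u| has a critical point at height m, the energy lost afterwards
   prevents u from climbing back to m. *)
Lemma no_return (p q m s : R) (f : R -> R) (b : Rbar) (u u1 : R -> R) (r1 r2 : R) :
  0 < p -> 0 < q -> (forall t, continuous f t) -> ode p q f b u u1 ->
  tends_at_end b u s -> m <= s ->
  0 < r1 < r2 -> dom b r2 -> (forall r, r1 <= r <= r2 -> Rabs (u r) <= m) ->
  (forall r, r2 <= r -> dom b r -> - m <= u r) ->
  u r1 <> u r2 -> Rabs (u r1) = m -> u1 r1 = 0 ->
  RInt f 0 (u r1) < RInt f 0 m.
Proof.
intros hp hq hf h hs hms h12 hr2 hm hlow hne hm1 hu1.
apply Rnot_le_lt; intros hPhi.
assert (E1 := energy_strictly_decreasing p q m f b u u1 r1 r2 hp hq hf h h12 hr2 hm hne).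
(* The strict loss of energy puts [kappa] above Phi(u r1), hence above Phi(m) by the hypothesis to
   be refuted. From [r2] on, Phi(u) >= [kappa] as long as |u| <= m, which fails once u is close to
   [m]. *)
set (kappa := - energy q m f u u1 r2).
assert (hk : RInt f 0 (u r1) < kappa).
{ unfold kappa; revert E1; unfold energy at 2.
  replace (m ^ 2 - u r1 ^ 2) with 0 by (rewrite <- hm1, pow2_abs; ring).
  rewrite hu1; unfold Rdiv; lra. }
assert (hc : continuous (RInt f 0) m).
{ exact (is_derive_continuous _ _ _ (is_derive_primitive f m hf)). }
destruct (proj1 (continuous_eps _ m) hc (kappa - RInt f 0 m) ltac:(lra)) as [e [he H]].
destruct (approach_level b u s m r2 e) as [r [hr [hdr [hle hnear]]]]; auto.
{ intros r hr; exact (ode_continuous p q f b u u1 r h hr). }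
{ specialize (hm r2 ltac:(lra)); apply Rabs_le_between in hm; lra. }
specialize (H _ hnear); apply Rabs_def2 in H.
assert (hm' : forall x, r2 <= x <= r -> Rabs (u x) <= m).
{ intros x hx; apply Rabs_le; split; [|apply hle, hx].
  apply hlow; [lra|]; apply (dom_le b x r); [lra|exact hdr]. }
assert (E2 : energy q m f u u1 r <= energy q m f u u1 r2).
{ apply (energy_decreasing p q m f b); auto; lra. }
assert (E3 : - RInt f 0 (u r) <= energy q m f u u1 r).
{ unfold energy.
  assert (0 <= u1 r ^ 2) by apply pow2_ge_0.
  assert (0 <= q * (m ^ 2 - u r ^ 2) / (2 * r ^ 2)); [|lra].
  apply Rmult_le_pos; [apply Rmult_le_pos; [lra|apply Rabs_le_sq, hm'; lra]|].
  left; apply Rinv_0_lt_compat, Rmult_lt_0_compat; [lra|apply pow_lt, (proj1 hdr)]. }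
unfold kappa in H; lra.
Qed.

(** A drop u x > u y produces an interior maximum on (0, y). Applied with [m] equal to that maximum,
    [no_return] would give Phi(m) < Phi(m). *)
Lemma solution_nondecreasing (p q s : R) (f : R -> R) (b : Rbar) (u u1 : R -> R) (x y : R) :
  0 < p -> 0 < q -> (forall t, continuous f t) -> ode p q f b u u1 ->
  tends_at_zero u -> tends_at_end b u s -> (forall r, dom b r -> 0 <= u r <= s) ->
  0 < x <= y -> dom b y -> u x <= u y.
Proof.
intros hp hq hf h h0 hs hbd hxy hy; apply Rnot_lt_le; intros hlt.
assert (hxy' : x < y) by (destruct hxy as [_ [h1| ->]]; [exact h1|lra]).
assert (hrestr : ode p q f y u u1).
{ apply (ode_restrict p q f b); [apply Rbar_lt_le, (proj2 hy)|exact h]. }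
assert (hxd : dom y x) by (apply dom_finite; lra).
destruct (interior_max_of_limits y u x (u y)) as [r1 [hr1 hmax]]; auto.
{ intros r hr; exact (ode_continuous p q f y u u1 r hrestr hr). }
{ apply tends_at_end_finite; [lra|exact (ode_continuous p q f b u u1 y h hy)]. }
{ specialize (hbd y hy); lra. }
destruct (max_derivatives y u u1 r1 (f (u r1) - p / r1 * u1 r1 + q / r1 ^ 2 * u r1))
  as [e1 _]; auto; try (intros; apply hrestr; assumption).
assert (hlt1 : u y < u r1) by (specialize (hmax x hxd); lra).
apply (proj1 (dom_finite y r1)) in hr1.
assert (hdom : forall r, r1 <= r <= y -> dom b r).
{ intros r hr; apply (dom_le b r y); [lra|exact hy]. }
assert (hu := hbd r1 (hdom r1 ltac:(lra))).
apply (Rlt_irrefl (RInt f 0 (u r1))).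
apply (no_return p q (u r1) s f b u u1 r1 y); auto; try lra.
- intros r hr; specialize (hbd r (hdom r hr)).
  rewrite Rabs_pos_eq by lra.
  destruct (Req_dec r y) as [-> |hne]; [lra|].
  apply hmax, dom_finite; lra.
- intros r _ hr; specialize (hbd r hr); lra.
- apply Rabs_pos_eq; lra.
Qed.

Lemma solution_nonneg (p q s sm : R) (f : R -> R) (b : Rbar) (u u1 : R -> R) :
  0 < p -> 0 < q -> (forall t, continuous f t) -> ode p q f b u u1 ->
  tends_at_zero u -> tends_at_end b u s ->
  0 < s -> - s <= sm < 0 -> f 0 = 0 -> (forall t, t < sm -> f t <= 0) ->
  (forall t, 0 < t <= - sm -> f t + f (- t) <= 0) ->
  forall r, dom b r -> 0 <= u r.
Proof.
intros hp hq hf h h0 hs hs0 hsm hf0 hneg hodd x hx.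
apply Rnot_lt_le; intros hux.
assert (hcont : forall r, dom b r -> continuous u r).
{ intros r hr; exact (ode_continuous p q f b u u1 r h hr). }
(* Keeps the depth of the minimum below [- sm], hence below [s], so that both [hodd] and [no_return]
   apply at that depth. *)
assert (hlow := minimum_principle p q f b u u1 sm s hq h h0 hs ltac:(lra) ltac:(lra) hneg).
assert (hopp := ode_opp p q f b u u1 h).
destruct (interior_max_of_limits b (fun r => - u r) x (- s)) as [r1 [hr1 hmin]]; auto; try lra.
{ intros r hr; apply (continuous_opp (V := R_NormedModule)), hcont, hr. }
{ intros eps heps; destruct (h0 eps heps) as [d [hd H]]; exists d; split; auto.
  intros r hr; rewrite Rabs_Ropp; auto. }
{ intros eps heps; destruct (hs eps heps) as [c [hc H]]; exists c; split; auto.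
  intros r hr hrb; replace (- u r - - s) with (- (u r - s)) by ring.
  rewrite Rabs_Ropp; auto. }
destruct (max_derivatives b (fun r => - u r) (fun r => - u1 r) r1
  (- f (- - u r1) - p / r1 * - u1 r1 + q / r1 ^ 2 * - u r1)) as [e1 _];
  auto; try (intros; apply hopp; assumption).
assert (hur1 : u r1 < 0) by (specialize (hmin x hx); lra).
assert (hr1' := proj1 hr1).
destruct (hs s hs0) as [c [hc Hc]].
assert (hC : dom b (Rmax c r1)) by (unfold Rmax; destruct (Rle_dec c r1); auto).
destruct (dom_above b _ hC) as [y [hy hdy]].
assert (h1 := Rmax_l c r1); assert (h2 := Rmax_r c r1).
specialize (Hc y ltac:(lra) (proj2 hdy)); apply Rabs_def2 in Hc.
assert (hdom : forall r, r1 <= r <= y -> dom b r).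
{ intros r hr; apply (dom_le b r y); [lra|exact hdy]. }
(* u is positive near the end, so it has a first zero [r2] after its minimum; between the two, |u|
   is at most the depth of the minimum. *)
destruct (first_crossing u r1 y 0) as [r2 [hr2 [hu2 hle]]]; try lra.
{ intros r hr; apply hcont, hdom, hr. }
assert (hr12 : r1 < r2).
{ destruct hr2 as [[hlt|heq] _]; [exact hlt|rewrite <- heq in hu2; lra]. }
set (m := - u r1).
assert (hm : m <= - sm) by (unfold m; specialize (hlow r1 hr1); lra).
assert (hPhi : RInt f 0 (u r1) < RInt f 0 m).
{ apply (no_return p q m s f b u u1 r1 r2); auto; try lra; try (unfold m; lra).
  - apply hdom; lra.
  - intros r hr; specialize (hle r hr); specialize (hmin r (hdom r ltac:(lra))).
    apply Rabs_le; unfold m; lra.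
  - intros r _ hr; specialize (hmin r hr); unfold m; lra.
  - unfold m; rewrite Rabs_left; lra. }
(* Phi(t) - Phi(-t) has derivative f(t) + f(-t) <= 0 and vanishes at 0. *)
assert (hode : RInt f 0 m - RInt f 0 (- m) <= RInt f 0 0 - RInt f 0 (- 0)).
{ apply (derive_nonpos_le (fun t => RInt f 0 t - RInt f 0 (- t)) (fun t => f t + f (- t))).
  - unfold m; lra.
  - intros t _; replace (f t + f (- t)) with (f t - (-1 * f (- t))) by ring.
    apply (is_derive_minus (V := R_NormedModule)); [apply is_derive_primitive, hf|].
    apply (is_derive_comp (V := R_NormedModule) (RInt f 0) (fun t => - t)).
    + apply is_derive_primitive, hf.
    + auto_derive; [easy|ring].
  - intros t ht; destruct (Req_dec t 0) as [-> |hne].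
    + rewrite Ropp_0, hf0; lra.
    + apply hodd; lra. }
rewrite Ropp_0 in hode; unfold m in *; rewrite Ropp_involutive in hode; lra.
Qed.

(** * Strict bounds for solutions; the equation under differences and scaling *)

Lemma is_derive_Rmult (f g : R -> R) (x df dg : R) :
  is_derive f x df -> is_derive g x dg ->
  is_derive (fun t => f t * g t) x (df * g x + f x * dg).
Proof. intros hf hg; exact (is_derive_mult f g x df dg hf hg Rmult_comm). Qed.

Lemma is_derive_Rpower (a r : R) : 0 < r ->
  is_derive (fun x => Rpower x a) r (a / r * Rpower r a).
Proof.
intros hr; apply is_derive_Reals.
replace (a / r * Rpower r a) with (a * Rpower r (a - 1)).
- apply derivable_pt_lim_power, hr.
- replace (Rpower r a) with (Rpower r (a - 1) * r); [field; lra|].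
  rewrite <- (Rpower_1 r hr) at 2; rewrite <- Rpower_plus; f_equal; ring.
Qed.

Lemma Rpower_pos (x a : R) : 0 < Rpower x a.
Proof. apply exp_pos. Qed.

(* In terms of the quotient u / r^al, the equation reads
   (r^(p+2al) (u/r^al)')' = r^(p+al) f(u), so f <= 0 propagates u = 0 to the right. *)
Lemma solution_pos (p q s al : R) (f : R -> R) (b : Rbar) (u u1 : R -> R) :
  0 < s -> al * al + (p - 1) * al = q -> ode p q f b u u1 -> tends_at_end b u s ->
  (forall r, dom b r -> 0 <= u r <= s) -> (forall t, 0 <= t <= s -> f t <= 0) ->
  forall r, dom b r -> 0 < u r.
Proof.
intros hs0 hal h hs hbd hf r0 hr0.
destruct (Rle_lt_or_eq_dec 0 (u r0) (proj1 (hbd r0 hr0))) as [hpos|hz]; [exact hpos|exfalso].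
assert (hopp := ode_opp p q f b u u1 h).
(* A zero of a nonnegative function is a minimum, so u' vanishes there as well. *)
destruct (max_derivatives b (fun r => - u r) (fun r => - u1 r) r0
  (- f (- - u r0) - p / r0 * - u1 r0 + q / r0 ^ 2 * - u r0)) as [e1 _];
  auto; try (intros; apply hopp; assumption).
{ intros r hr; specialize (hbd r hr); lra. }
assert (hr0' := proj1 hr0).
(* The weighted flux r^(p+2al) (u / r^al)' = r^(p+al) (u' - al u / r) is zero at [r0] and
   nonincreasing, so u / r^al cannot grow away from 0, against the limit s > 0. *)
assert (hle : forall r, r0 <= r -> dom b r -> u1 r - al / r * u r <= 0).
{ intros r hr hd.
  assert (hQ : Rpower r (p + al) * (u1 r - al / r * u r)
    <= Rpower r0 (p + al) * (u1 r0 - al / r0 * u r0)).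
  { apply (derive_nonpos_le (fun r => Rpower r (p + al) * (u1 r - al / r * u r))
      (fun r => Rpower r (p + al) * f (u r))); [exact hr| |].
    - intros x hx; assert (hxd : dom b x) by (apply (dom_le b x r); [lra|exact hd]).
      destruct (h x hxd) as [h1 h2].
      (* The weight exponent cancels the terms in u', and the indicial equation [hal] those in u. *)
      replace (Rpower x (p + al) * f (u x)) with
        ((p + al) / x * Rpower x (p + al) * (u1 x - al / x * u x)
         + Rpower x (p + al) * ((f (u x) - p / x * u1 x + q / x ^ 2 * u x)
           - (- al / x ^ 2 * u x + al / x * u1 x)))
        by (rewrite <- hal; field; lra).
      apply (is_derive_Rmult (fun r => Rpower r (p + al)) (fun r => u1 r - al / r * u r));
        [apply is_derive_Rpower; lra|].
      apply (is_derive_minus (V := R_NormedModule)); [exact h2|].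
      apply (is_derive_Rmult (fun x => al / x) u); [|exact h1].
      auto_derive; [lra|field; lra].
    - intros x hx; assert (hxd : dom b x) by (apply (dom_le b x r); [lra|exact hd]).
      assert (h1 := hf (u x) (hbd x hxd)); assert (h2 := Rpower_pos x (p + al)); nra. }
  replace (u1 r0 - al / r0 * u r0) with 0 in hQ by (rewrite <- hz; lra).
  assert (h2 := Rpower_pos r (p + al)); nra. }
assert (hzero : forall r, r0 <= r -> dom b r -> u r <= 0).
{ intros r hr hd.
  assert (hV : Rpower r (- al) * u r <= Rpower r0 (- al) * u r0).
  { apply (derive_nonpos_le (fun r => Rpower r (- al) * u r)
      (fun r => Rpower r (- al) * (u1 r - al / r * u r))); [exact hr| |].
    - intros x hx; assert (hxd : dom b x) by (apply (dom_le b x r); [lra|exact hd]).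
      replace (Rpower x (- al) * (u1 x - al / x * u x)) with
        (- al / x * Rpower x (- al) * u x + Rpower x (- al) * u1 x) by (field; lra).
      apply (is_derive_Rmult (fun r => Rpower r (- al)) u); [apply is_derive_Rpower; lra|].
      apply h, hxd.
    - intros x hx; assert (hxd : dom b x) by (apply (dom_le b x r); [lra|exact hd]).
      specialize (hle x ltac:(lra) hxd).
      assert (h2 := Rpower_pos x (- al)); nra. }
  rewrite <- hz in hV; assert (h2 := Rpower_pos r (- al)); nra. }
destruct (hs s hs0) as [c [hc Hc]].
assert (hC : dom b (Rmax c r0)) by (unfold Rmax; destruct (Rle_dec c r0); auto).
destruct (dom_above b _ hC) as [y [hy hdy]].
assert (h1 := Rmax_l c r0); assert (h2 := Rmax_r c r0).
specialize (Hc y ltac:(lra) (proj2 hdy)); apply Rabs_def2 in Hc.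
specialize (hzero y ltac:(lra) hdy); lra.
Qed.

(** A contact with [s] would be a maximum, yet u'' = q s / r^2 > 0 there. *)
Lemma solution_lt (p q s : R) (f : R -> R) (b : Rbar) (u u1 : R -> R) :
  0 < q -> 0 < s -> ode p q f b u u1 -> (forall r, dom b r -> u r <= s) -> f s = 0 ->
  forall r, dom b r -> u r < s.
Proof.
intros hq hs h hbd hf r hr.
destruct (Rle_lt_or_eq_dec (u r) s (hbd r hr)) as [hlt|heq]; [exact hlt|exfalso].
destruct (max_derivatives b u u1 r (f (u r) - p / r * u1 r + q / r ^ 2 * u r))
  as [e1 e2]; auto; try (intros; apply h; assumption).
{ intros x hx; rewrite heq; apply hbd, hx. }
rewrite e1, heq, hf in e2.
assert (h1 := inv_sq_pos q r hq (proj1 hr)).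
assert (0 < q / r ^ 2 * s) by (apply Rmult_lt_0_compat; lra).
lra.
Qed.

(** The friction terms cancel because v' = w' at the maximum. Two nonlinearities are allowed so that
    one function may be a rescaled solution. *)
Lemma difference_at_max (p q : R) (f g : R -> R) (b : Rbar) (v v1 w w1 : R -> R) (r0 : R) :
  ode p q f b v v1 -> ode p q g b w w1 -> dom b r0 ->
  (forall r, dom b r -> v r - w r <= v r0 - w r0) ->
  f (v r0) - g (w r0) + q / r0 ^ 2 * (v r0 - w r0) <= 0.
Proof.
intros hv hw hr0 hmax.
destruct (max_derivatives b (fun r => v r - w r) (fun r => v1 r - w1 r) r0
  ((f (v r0) - p / r0 * v1 r0 + q / r0 ^ 2 * v r0)
   - (g (w r0) - p / r0 * w1 r0 + q / r0 ^ 2 * w r0))) as [e1 e2]; auto.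
- intros r hr; apply (is_derive_minus (V := R_NormedModule)); [apply hv|apply hw]; exact hr.
- apply (is_derive_minus (V := R_NormedModule)); [apply hv|apply hw]; exact hr0.
- replace (w1 r0) with (v1 r0) in e2 by lra; lra.
Qed.

Lemma ode_scale (p q la : R) (f : R -> R) (b b' : Rbar) (u u1 : R -> R) :
  0 < la -> (forall r, dom b' r -> dom b (la * r)) -> ode p q f b u u1 ->
  ode p q (fun t => la ^ 2 * f t) b' (fun r => u (la * r)) (fun r => la * u1 (la * r)).
Proof.
intros hla hdom h r hr; destruct (h _ (hdom r hr)) as [h1 h2]; assert (hr0 := proj1 hr).
assert (hlin : is_derive (fun r => la * r) r la) by (auto_derive; [easy|ring]).
split.
- apply (is_derive_comp (V := R_NormedModule) u (fun r => la * r)); assumption.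
- replace (la ^ 2 * f (u (la * r)) - p / r * (la * u1 (la * r)) + q / r ^ 2 * u (la * r))
    with (la * (la * (f (u (la * r)) - p / (la * r) * u1 (la * r)
      + q / (la * r) ^ 2 * u (la * r)))) by (field; lra).
  apply (is_derive_scal (fun r => u1 (la * r))).
  apply (is_derive_comp (V := R_NormedModule) u1 (fun r => la * r)); assumption.
Qed.

(** * Comparison by rescaling *)

(** Makes u(la r) meaningful for every r in (0, b) when la > 1 and [b] is finite: beyond the end, u
    keeps its boundary value. *)
Definition extend_by (b : Rbar) (s : R) (u : R -> R) (x : R) : R :=
  if Rbar_lt_dec x b then u x else s.

Lemma extend_by_in (b : Rbar) (s : R) (u : R -> R) (x : R) :
  Rbar_lt x b -> extend_by b s u x = u x.
Proof. unfold extend_by; destruct (Rbar_lt_dec x b); easy. Qed.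

Lemma extend_by_continuous (b : Rbar) (s : R) (u : R -> R) (x : R) :
  (forall r, dom b r -> continuous u r) -> tends_at_end b u s -> 0 < x ->
  continuous (extend_by b s u) x.
Proof.
intros hu hs hx; apply continuous_eps; intros eps heps.
destruct (Rbar_lt_dec x b) as [hxb|hxb].
- assert (hd : dom b x) by (split; assumption).
  destruct (dom_locally b x hd) as [d1 [hd1 H1]].
  destruct (proj1 (continuous_eps u x) (hu x hd) eps heps) as [d2 [hd2 H2]].
  assert (h1 := Rmin_l d1 d2); assert (h2 := Rmin_r d1 d2).
  exists (Rmin d1 d2); split; [apply Rmin_pos; assumption|].
  intros y hy; rewrite !extend_by_in; [apply H2; lra|exact hxb|].
  apply (H1 y); lra.
- destruct (hs eps heps) as [c [[hc0 hc] H]].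
  assert (hcx : c < x).
  { apply Rbar_not_lt_le in hxb.
    exact (Rbar_lt_le_trans c b x hc hxb). }
  exists (x - c); split; [lra|]; intros y hy; apply Rabs_def2 in hy.
  unfold extend_by at 2; destruct (Rbar_lt_dec x b) as [h|_]; [easy|].
  unfold extend_by; destruct (Rbar_lt_dec y b) as [h|_].
  + apply H; [lra|exact h].
  + rewrite Rminus_diag, Rabs_R0; exact heps.
Qed.

Definition monotone_profile (b : Rbar) (s : R) (u : R -> R) : Prop :=
  (forall r, dom b r -> 0 < u r < s) /\
  (forall x y, 0 < x <= y -> dom b y -> u x <= u y) /\
  tends_at_zero u /\ tends_at_end b u s.

Lemma extend_by_mono (b : Rbar) (s : R) (u : R -> R) (x y : R) :
  monotone_profile b s u -> 0 < x <= y -> extend_by b s u x <= extend_by b s u y.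
Proof.
intros [hbd [hmono _]] hxy; unfold extend_by.
destruct (Rbar_lt_dec x b) as [hx|hx]; destruct (Rbar_lt_dec y b) as [hy|hy].
- apply hmono; [exact hxy|split; [lra|exact hy]].
- left; apply hbd; split; [lra|exact hx].
- exfalso; apply hx; exact (Rbar_le_lt_trans x y b (proj2 hxy) hy).
- lra.
Qed.

Lemma extend_by_lt (b : Rbar) (s : R) (u : R -> R) (x : R) :
  0 < x -> extend_by b s u x < s -> dom b x /\ extend_by b s u x = u x.
Proof.
unfold extend_by; destruct (Rbar_lt_dec x b) as [h|h]; intros; [|lra].
split; [split; assumption|reflexivity].
Qed.

(** The extension is invisible near a maximum with [la * r0] inside the interval: for y slightly
    beyond [la * r0], everything takes place on (0, y / la), where u(la .) solves the rescaled
    equation. *)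
Lemma rescaled_difference_at_max (p q s la : R) (f : R -> R) (b : Rbar)
  (u u1 v v1 : R -> R) (r0 : R) :
  ode p q f b u u1 -> ode p q f b v v1 -> 1 <= la -> dom b (la * r0) -> 0 < r0 ->
  (forall r, dom b r -> v r - extend_by b s u (la * r) <= v r0 - extend_by b s u (la * r0)) ->
  f (v r0) - la ^ 2 * f (u (la * r0)) + q / r0 ^ 2 * (v r0 - u (la * r0)) <= 0.
Proof.
intros hu hv hla hr0 hr00 hmax.
destruct (dom_above b _ hr0) as [y [hy hdy]].
assert (hscale : forall r, dom (y / la) r -> dom b (la * r)).
{ intros r hr; apply (proj1 (dom_finite _ _)) in hr.
  destruct hr as [hr1 hr2]; apply (Rmult_lt_compat_l la) in hr2; [|lra].
  replace (la * (y / la)) with y in hr2 by (field; lra).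
  apply (dom_le b _ y); [split; [nra|lra]|exact hdy]. }
assert (hle : Rbar_le (y / la) b).
{ apply (Rbar_le_trans _ y); [|apply Rbar_lt_le, (proj2 hdy)].
  simpl; apply Rle_div_l; [lra|]; destruct hdy; nra. }
apply (difference_at_max p q f (fun t => la ^ 2 * f t) (y / la) v v1
  (fun r => u (la * r)) (fun r => la * u1 (la * r)) r0).
- exact (ode_restrict p q f b _ v v1 hle hv).
- apply (ode_scale p q la f b); [lra|exact hscale|exact hu].
- apply dom_finite; split; [exact hr00|].
  apply (Rmult_lt_reg_l la); [lra|].
  replace (la * (y / la)) with y by (field; lra); exact hy.
- intros r hr.
  assert (hrb : dom b r).
  { destruct hr as [h1 h2]; split; [exact h1|].
    exact (Rbar_lt_le_trans r (y / la) b h2 hle). }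
  specialize (hmax r hrb).
  rewrite !extend_by_in in hmax; [exact hmax|exact (proj2 hr0)|].
  exact (proj2 (hscale r hr)).
Qed.

(* A positive maximum of v - u(la .) can sit neither near 0, where q / r^2 beats
   the Lipschitz constant of f, nor near the end, where f is increasing. *)
Lemma violation_in_compact (p q s K : R) (f : R -> R) (b : Rbar)
  (u u1 v v1 : R -> R) (rho0 rho1 la x : R) :
  0 < q -> ode p q f b u u1 -> ode p q f b v v1 ->
  monotone_profile b s u -> monotone_profile b s v ->
  (forall t, 0 < t < s -> f t < 0) ->
  (forall t t', 0 <= t <= s -> 0 <= t' <= s -> Rabs (f t - f t') <= K * Rabs (t - t')) ->
  0 < rho0 -> K < q / rho0 ^ 2 -> dom b rho1 ->
  (forall t t', u rho1 <= t -> t <= t' -> t' < s -> f t <= f t') ->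
  1 <= la -> dom b x -> extend_by b s u (la * x) < v x ->
  exists r, rho0 <= r <= rho1 /\ extend_by b s u (la * r) < v r.
Proof.
intros hq hu hv hpu hpv hneg hK hrho0 hKq hrho1 hinc hla hx hbad.
assert (hcu : forall r, dom b r -> continuous u r).
{ intros r hr; exact (ode_continuous p q f b u u1 r hu hr). }
pose proof hpu as [hub [hum [hu0 hus]]].
pose proof hpv as [hvb [hvm [hv0 hvs]]].
set (w := fun r => extend_by b s u (la * r)) in *.
assert (hw : forall r, dom b r -> 0 < w r <= s /\ u r <= w r).
{ intros r hr; assert (hr0 := proj1 hr).
  assert (hm := extend_by_mono b s u r (la * r) hpu ltac:(nra)).
  rewrite (extend_by_in b s u r (proj2 hr)) in hm; fold (w r) in hm.
  assert (h1 := hub r hr); split; [|exact hm]; split; [lra|].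
  unfold w, extend_by; destruct (Rbar_lt_dec (la * r) b) as [h|h]; [|lra].
  left; apply hub; split; [nra|exact h]. }
assert (hpos : 0 < v x - w x) by (unfold w; lra).
destruct (interior_max b (fun r => v r - w r) x) as [r0 [hr0 hmax]]; auto.
- intros r hr; apply (continuous_minus (V := R_NormedModule)).
  + exact (ode_continuous p q f b v v1 r hv hr).
  + apply (continuous_comp (fun r => la * r) (extend_by b s u)).
    * apply (continuous_scal_r (V := R_NormedModule)), continuous_id.
    * apply extend_by_continuous; auto; destruct hr; nra.
- destruct (hv0 _ hpos) as [d [hd H]].
  assert (hm1 := Rmin_l d x); assert (hm2 := Rmin_r d x); assert (hx0 := proj1 hx).
  exists (Rmin d x); split; [apply Rmin_pos; lra|].
  intros r hr; specialize (H r ltac:(lra)); apply Rabs_def2 in H.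
  assert (hdr : dom b r) by (apply (dom_le b r x); [lra|exact hx]).
  specialize (hw r hdr); lra.
- destruct (hus _ hpos) as [c [hc H]]; exists c; split; [exact hc|].
  intros r hr hrb; specialize (H r hr hrb); apply Rabs_def2 in H.
  assert (hdr : dom b r) by (split; [destruct hc; lra|exact hrb]).
  specialize (hw r hdr); specialize (hvb r hdr); lra.
- exists r0; assert (hz : 0 < v r0 - w r0) by (specialize (hmax x hx); lra).
  split; [|unfold w in hz; lra].
  assert (hr00 := proj1 hr0); assert (hv_r0 := hvb r0 hr0); assert (hw_r0 := hw r0 hr0).
  (* w < v < s at [r0] excludes the constant part of the extension. *)
  destruct (extend_by_lt b s u (la * r0)) as [hdl heq]; [nra|fold (w r0); lra|].
  fold (w r0) in heq.
  assert (hdiff := rescaled_difference_at_max p q s la f b u u1 v v1 r0 hu hv hla hdl hr00 hmax).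
  rewrite <- heq in hdiff.
  assert (hf := hneg (w r0) ltac:(lra)).
  assert (hla2 : 1 <= la ^ 2) by nra.
  (* Since f (w r0) < 0, replacing la^2 by 1 only lowers the left-hand side. *)
  assert (hdiff2 : f (v r0) - f (w r0) + q / r0 ^ 2 * (v r0 - w r0) <= 0) by nra.
  split; apply Rnot_lt_le; intros hlt.
  + assert (hL := hK (v r0) (w r0) ltac:(lra) ltac:(lra)).
    rewrite (Rabs_pos_eq (v r0 - w r0)) in hL by lra.
    apply Rabs_le_between in hL.
    assert (hq2 : q / rho0 ^ 2 <= q / r0 ^ 2).
    { apply Rmult_le_compat_l; [lra|]; apply Rinv_le_contravar; [apply pow_lt, hr00|].
      apply pow_incr; lra. }
    nra.
  + assert (hI := hinc (w r0) (v r0)).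
    assert (hu1' := hum rho1 r0 ltac:(destruct hrho1; lra) hr0).
    specialize (hI ltac:(lra) ltac:(lra) ltac:(lra)).
    assert (hq2 := inv_sq_pos q r0 hq hr00); nra.
Qed.

(** The supremum of the scales at which u(la .) fails to dominate v is above 1 and is itself a good
    scale. A contact there contradicts the equation because la^2 > 1; without contact, compactness
    of [rho0, rho1] leaves a uniform gap, so scales slightly below the supremum are good too. *)
Lemma comparison (p q s K eps : R) (f : R -> R) (b : Rbar) (u u1 v v1 : R -> R) :
  0 < q -> ode p q f b u u1 -> ode p q f b v v1 ->
  monotone_profile b s u -> monotone_profile b s v ->
  (forall t, 0 < t < s -> f t < 0) ->
  (forall t t', 0 <= t <= s -> 0 <= t' <= s -> Rabs (f t - f t') <= K * Rabs (t - t')) ->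
  0 < eps -> (forall t t', s - eps <= t -> t <= t' -> t' < s -> f t <= f t') ->
  forall r, dom b r -> v r <= u r.
Proof.
intros hq hu hv hpu hpv hneg hK heps hinc x hx.
apply Rnot_lt_le; intros hbad.
assert (hcu : forall r, dom b r -> continuous u r).
{ intros r hr; exact (ode_continuous p q f b u u1 r hu hr). }
assert (hcv : forall r, dom b r -> continuous v r).
{ intros r hr; exact (ode_continuous p q f b v v1 r hv hr). }
pose proof hpu as [hub [hum [hu0 hus]]].
pose proof hpv as [hvb [hvm [hv0 hvs]]].
assert (hcw : forall r, 0 < r -> continuous (extend_by b s u) r).
{ intros r hr; apply extend_by_continuous; auto. }
destruct (hus eps heps) as [c [hc Hc]].
destruct (dom_above b c hc) as [rho1 [hrho1c hrho1]].
specialize (Hc rho1 hrho1c (proj2 hrho1)); apply Rabs_def2 in Hc.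
assert (hinc' : forall t t', u rho1 <= t -> t <= t' -> t' < s -> f t <= f t').
{ intros t t' h1 h2 h3; apply hinc; lra. }
assert (hrho10 := proj1 hrho1).
(* With rho0 <= 1 one has rho0^2 <= rho0 <= q / (|K| + 1), whence q / rho0^2 >= |K| + 1 > K. *)
assert (hex : exists rho0, 0 < rho0 <= rho1 /\ K < q / rho0 ^ 2).
{ assert (hk : 0 < q / (Rabs K + 1)).
  { apply Rdiv_lt_0_compat; [exact hq|]; assert (h := Rabs_pos K); lra. }
  assert (hm1 := Rmin_l rho1 (Rmin 1 (q / (Rabs K + 1)))).
  assert (hm2 := Rmin_r rho1 (Rmin 1 (q / (Rabs K + 1)))).
  assert (hm3 := Rmin_l 1 (q / (Rabs K + 1))); assert (hm4 := Rmin_r 1 (q / (Rabs K + 1))).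
  assert (hm0 : 0 < Rmin rho1 (Rmin 1 (q / (Rabs K + 1)))) by (repeat apply Rmin_pos; lra).
  set (rho0 := Rmin rho1 (Rmin 1 (q / (Rabs K + 1)))) in *.
  exists rho0; split; [lra|].
  apply Rlt_le_trans with (Rabs K + 1); [assert (h := Rle_abs K); lra|].
  apply (Rmult_le_reg_r (rho0 ^ 2)); [apply pow_lt, hm0|].
  replace (q / rho0 ^ 2 * rho0 ^ 2) with q by (field; lra).
  assert (hKp := Rabs_pos K).
  assert (h1 : rho0 * (Rabs K + 1) <= q).
  { apply (Rmult_le_reg_r (/ (Rabs K + 1))); [apply Rinv_0_lt_compat; lra|].
    rewrite Rmult_assoc, Rinv_r by lra; unfold Rdiv in *; lra. }
  nra. }
destruct hex as [rho0 [hrho0 hKq]].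
set (bad := fun la => exists r, rho0 <= r <= rho1 /\ extend_by b s u (la * r) < v r).
assert (hcompact : forall la, 1 <= la ->
  forall y, dom b y -> extend_by b s u (la * y) < v y -> bad la).
{ intros la hla y hy hlt.
  apply (violation_in_compact p q s K f b u u1 v v1 rho0 rho1 la y); auto; lra. }
assert (hdom : forall r, rho0 <= r <= rho1 -> dom b r).
{ intros r hr; apply (dom_le b r rho1); [lra|exact hrho1]. }
assert (hopen : forall la, 1 <= la -> bad la -> exists la', la < la' /\ bad la').
{ intros la hla [r [hr hlt]].
  assert (hpos : 0 < v r - extend_by b s u (la * r)) by lra.
  assert (hlar : 0 < la * r) by nra.
  destruct (proj1 (continuous_eps _ _) (hcw _ hlar) _ hpos) as [d [hd H]].
  assert (hdr : 0 < d / (2 * r)) by (apply Rdiv_lt_0_compat; lra).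
  exists (la + d / (2 * r)); split; [lra|]; exists r; split; [exact hr|].
  specialize (H ((la + d / (2 * r)) * r)).
  replace ((la + d / (2 * r)) * r - la * r) with (d / 2) in H by (field; lra).
  rewrite Rabs_pos_eq in H by lra; specialize (H ltac:(lra)).
  apply Rabs_def2 in H; lra. }
(* Pick y with u y > v rho1. For la > y / rho0 and r in [rho0, rho1], u(la r) >= u y > v rho1 >= v
   r. *)
assert (hbound : exists L, forall la, bad la -> la <= L).
{ assert (hvr := hvb rho1 hrho1).
  destruct (hus (s - v rho1) ltac:(lra)) as [c2 [hc2 Hc2]].
  destruct (dom_above b c2 hc2) as [y [hy hdy]].
  specialize (Hc2 y hy (proj2 hdy)); apply Rabs_def2 in Hc2.
  exists (y / rho0); intros la [r [hr hlt]]; apply Rnot_lt_le; intros hla.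
  apply (Rmult_lt_compat_r rho0) in hla; [|lra].
  replace (y / rho0 * rho0) with y in hla by (field; lra).
  assert (hy0 := proj1 hdy).
  assert (hla0 : 0 < la) by nra.
  assert (hm := extend_by_mono b s u y (la * r) hpu ltac:(nra)).
  rewrite (extend_by_in b s u y (proj2 hdy)) in hm.
  assert (hm2 := hvm r rho1 ltac:(lra) hrho1); lra. }
destruct hbound as [L hL].
assert (hbad1 : bad 1).
{ apply (hcompact 1 ltac:(lra) x hx); rewrite Rmult_1_l, extend_by_in; [lra|exact (proj2 hx)]. }
destruct (completeness (fun la => bad la)) as [la [hub_la hleast]].
{ exists L; intros y hy; apply hL, hy. }
{ exists 1; exact hbad1. }
assert (hla : 1 < la).
{ destruct (hopen 1 ltac:(lra) hbad1) as [la' [h1 h2]]; specialize (hub_la la' h2); lra. }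
assert (hnot : ~ bad la).
{ intros hb1; destruct (hopen la ltac:(lra) hb1) as [la' [h1 h2]].
  specialize (hub_la la' h2); lra. }
assert (hle : forall r, dom b r -> v r <= extend_by b s u (la * r)).
{ intros r hr; apply Rnot_lt_le; intros h; apply hnot, (hcompact la ltac:(lra) r hr h). }
destruct (classic (exists r, rho0 <= r <= rho1 /\ v r = extend_by b s u (la * r)))
  as [[r [hr heq]]|hno].
- assert (hdr := hdom r hr); assert (hvr := hvb r hdr).
  destruct (extend_by_lt b s u (la * r)) as [hdl hequ]; [nra|lra|].
  assert (hdiff := rescaled_difference_at_max p q s la f b u u1 v v1 r hu hv
    ltac:(lra) hdl ltac:(lra)).
  rewrite <- hequ, <- heq in hdiff.
  assert (hf := hneg (v r) hvr).
  specialize (hdiff ltac:(intros y hy; specialize (hle y hy); lra)).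
  (* The inequality at the contact is now (1 - la^2) f (v r) <= 0, whereas f (v r) < 0. *)
  rewrite Rminus_diag, Rmult_0_r in hdiff; assert (hla2 : 1 < la ^ 2) by nra; nra.
- destruct (continuity_ab_maj (fun r => v r - extend_by b s u (la * r)) rho0 rho1)
    as [M [HM hM]]; [lra| |].
  { intros r hr; apply continuous_continuity_pt, (continuous_minus (V := R_NormedModule)).
    - apply hcv, hdom, hr.
    - apply (continuous_comp (fun r => la * r) (extend_by b s u)).
      + apply (continuous_scal_r (V := R_NormedModule)), continuous_id.
      + apply hcw; nra. }
  assert (hgap : v M < extend_by b s u (la * M)).
  { destruct (hle M (hdom M hM)) as [h|h]; [exact h|].
    exfalso; apply hno; exists M; auto. }
  assert (hgap0 : 0 < extend_by b s u (la * M) - v M) by lra.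
  (* Uniform continuity with the gap as tolerance: a bad scale l in (la - d / rho1, la] moves the
     argument by less than [d], which is too little to close the gap. *)
  destruct (@Heine_cor2 (extend_by b s u) rho0 (la * rho1))
    with (eps := mkposreal _ hgap0) as [d Hd].
  { intros r hr; apply continuous_continuity_pt, hcw; lra. }
  assert (hd := cond_pos d).
  assert (hdr : 0 < d / rho1) by (apply Rdiv_lt_0_compat; lra).
  destruct (classic (exists l, bad l /\ Rmax 1 (la - d / rho1) < l)) as [[l [hbl hl]]|hno2].
  + assert (h1 := Rmax_l 1 (la - d / rho1)); assert (h2 := Rmax_r 1 (la - d / rho1)).
    assert (hlle := hub_la l hbl); destruct hbl as [r [hr hlt]].
    specialize (Hd (l * r) (la * r) ltac:(nra) ltac:(nra)).
    assert (hclose : Rabs (l * r - la * r) < d).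
    { replace (l * r - la * r) with (- ((la - l) * r)) by ring.
      rewrite Rabs_Ropp, Rabs_pos_eq by nra.
      apply Rle_lt_trans with ((la - l) * rho1); [nra|].
      replace (pos d) with (d / rho1 * rho1) by (field; lra); nra. }
    specialize (Hd hclose); simpl in Hd; apply Rabs_def2 in Hd.
    specialize (HM r hr); simpl in HM; lra.
  + assert (hcontra : la <= Rmax 1 (la - d / rho1)).
    { apply hleast; intros l hl; apply Rnot_lt_le; intros h; apply hno2; exists l; auto. }
    revert hcontra; apply Rlt_not_le, Rmax_lub_lt; lra.
Qed.

(** * The singular initial value problem at 0 *)

Lemma continuous_glue_zero (g : R -> R) (C : R) :
  (forall x, 0 < x -> continuous g x) -> (forall x, x <= 0 -> g x = 0) ->
  (forall x, 0 < x < 1 -> Rabs (g x) <= C * x) -> forall x, continuous g x.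
Proof.
intros hpos hneg hC x; destruct (Rlt_le_dec 0 x) as [hx|hx]; [apply hpos, hx|].
apply continuous_eps; intros eps heps; rewrite (hneg x hx).
assert (hC0 : 0 < Rabs C + 1) by (assert (h := Rabs_pos C); lra).
assert (hd : 0 < eps / (Rabs C + 1)) by (apply Rdiv_lt_0_compat; lra).
assert (h1 := Rmin_l 1 (eps / (Rabs C + 1))); assert (h2 := Rmin_r 1 (eps / (Rabs C + 1))).
exists (Rmin 1 (eps / (Rabs C + 1))); split; [apply Rmin_pos; lra|].
intros y hy; rewrite Rminus_0_r; apply Rabs_def2 in hy.
destruct (Rlt_le_dec 0 y) as [hy0|hy0]; [|rewrite (hneg y hy0), Rabs_R0; exact heps].
assert (h3 : y < eps / (Rabs C + 1)) by lra.
apply (Rmult_lt_compat_l (Rabs C + 1)) in h3; [|exact hC0].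
replace ((Rabs C + 1) * (eps / (Rabs C + 1))) with eps in h3 by (field; lra).
specialize (hC y ltac:(lra)); assert (h4 := Rle_abs C); nra.
Qed.

Lemma Rpower_le_id (x a : R) : 0 < x < 1 -> 1 <= a -> Rpower x a <= x.
Proof.
intros hx ha; rewrite <- (Rpower_1 x) at 2 by lra; unfold Rpower.
assert (hln : ln x < 0) by (rewrite <- ln_1; apply ln_increasing; lra).
destruct (Rle_lt_or_eq_dec 1 a ha) as [h| <-]; [|lra].
left; apply exp_increasing; nra.
Qed.

Lemma Rpower_continuous (a x : R) : 0 < x -> continuous (fun r => Rpower r a) x.
Proof. intros hx; exact (is_derive_continuous _ _ _ (is_derive_Rpower a x hx)). Qed.

Lemma Rpower_tends_at_zero (a C : R) : 0 < a -> 0 <= C ->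
  forall eps, 0 < eps -> exists d, 0 < d /\ forall r, 0 < r < d -> C * Rpower r a < eps.
Proof.
intros ha hC eps heps.
exists (Rpower (eps / (C + 1)) (/ a)); split; [apply Rpower_pos|].
intros r hr.
assert (he : 0 < eps / (C + 1)) by (apply Rdiv_lt_0_compat; lra).
assert (h : Rpower r a < Rpower (Rpower (eps / (C + 1)) (/ a)) a).
{ apply Rlt_Rpower_l; [exact ha|lra]. }
rewrite Rpower_mult, Rinv_l, Rpower_1 in h; [|exact he|lra].
apply (Rmult_lt_compat_l (C + 1)) in h; [|lra].
replace ((C + 1) * (eps / (C + 1))) with eps in h by (field; lra).
assert (h2 := Rpower_pos r a); nra.
Qed.

(* With u = r^al w the equation becomes (r^(p+2al) w')' = r^(p+al) f(r^al w);
   [flux_density] is the right-hand side and [slope] is w'.  Extending both by 0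
   to r <= 0 makes them continuous on the whole line. *)
Definition flux_density (p al : R) (f w : R -> R) (r : R) : R :=
  if Rlt_dec 0 r then Rpower r (p + al) * f (Rpower r al * w r) else 0.

Definition slope (p al : R) (f w : R -> R) (r : R) : R :=
  if Rlt_dec 0 r then RInt (flux_density p al f w) 0 r / Rpower r (p + 2 * al) else 0.

(** Volterra form of the equation for w with w(0) = c; a fixed point gives the solution r^al w. *)
Definition profile_step (p al : R) (f : R -> R) (c : R) (w : R -> R) (r : R) : R :=
  c + RInt (slope p al f w) 0 r.

(** The weight is a Gaussian exponential because the slope carries a factor r, and the integral of 2
    K r exp(K r^2) is exp(K r^2) up to a constant. *)
Definition admissible (K A : R) (w : R -> R) : Prop :=
  (forall x, 0 < x -> continuous w x) /\
  (forall x, 0 < x -> Rabs (w x) <= A * exp (K * x ^ 2)).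

Definition lipschitz (K : R) (f : R -> R) : Prop :=
  forall t t', Rabs (f t - f t') <= K * Rabs (t - t').

Lemma lipschitz_continuous (K : R) (f : R -> R) : 0 < K -> lipschitz K f ->
  forall t, continuous f t.
Proof.
intros hK hf t; apply continuous_eps; intros eps heps.
exists (eps / K); split; [apply Rdiv_lt_0_compat; assumption|].
intros y hy; apply Rle_lt_trans with (1 := hf y t).
apply (Rmult_lt_compat_l K) in hy; [|exact hK].
replace (K * (eps / K)) with eps in hy by (field; lra); exact hy.
Qed.

(** The inner factor r^al joins r^(p+al) to form exactly the power by which [slope] divides. *)
Lemma flux_density_diff (p al K : R) (f w w' : R -> R) (r : R) : lipschitz K f -> 0 < r ->
  Rabs (flux_density p al f w r - flux_density p al f w' r)
  <= Rpower r (p + 2 * al) * (K * Rabs (w r - w' r)).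
Proof.
intros hf hr; unfold flux_density; destruct (Rlt_dec 0 r) as [_|h]; [|lra].
rewrite <- Rmult_minus_distr_l, Rabs_mult, (Rabs_pos_eq (Rpower r (p + al)))
  by (left; apply Rpower_pos).
replace (p + 2 * al) with ((p + al) + al) by ring.
rewrite (Rpower_plus (p + al) al), Rmult_assoc.
apply Rmult_le_compat_l; [left; apply Rpower_pos|].
apply Rle_trans with (1 := hf _ _).
rewrite <- Rmult_minus_distr_l, Rabs_mult, (Rabs_pos_eq (Rpower r al))
  by (left; apply Rpower_pos).
lra.
Qed.

Lemma flux_density_zero (p al : R) (f : R -> R) (r : R) : f 0 = 0 ->
  flux_density p al f (fun _ => 0) r = 0.
Proof.
intros h; unfold flux_density; destruct (Rlt_dec 0 r) as [_|_]; [|reflexivity].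
rewrite Rmult_0_r, h; ring.
Qed.

Lemma exp_sq_le (K x y : R) : 0 < K -> 0 <= x <= y -> exp (K * x ^ 2) <= exp (K * y ^ 2).
Proof.
intros hK hxy.
assert (hsq : K * x ^ 2 <= K * y ^ 2) by (apply Rmult_le_compat_l; [lra|apply pow_incr, hxy]).
destruct hsq as [h| ->]; [left; apply exp_increasing, h|apply Rle_refl].
Qed.

Lemma admissible_nonneg (K A : R) (w : R -> R) : admissible K A w -> 0 <= A.
Proof.
intros [_ h]; specialize (h 1 ltac:(lra)).
assert (h1 := Rabs_pos (w 1)); assert (h2 := exp_pos (K * 1 ^ 2)); nra.
Qed.

(** Only the point 0 needs care: 1 <= p + 2 al gives r^(p+2al) <= r on (0, 1), hence a linear bound
    there. *)
Lemma flux_density_continuous (p al K A : R) (f w : R -> R) : 0 < K -> lipschitz K f -> f 0 = 0 ->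
  1 <= p + 2 * al -> admissible K A w ->
  forall x, continuous (flux_density p al f w) x.
Proof.
intros hK hf hf0 hm hw; assert (hA := admissible_nonneg K A w hw); destruct hw as [hc hb].
apply (continuous_glue_zero _ (K * (A * exp (K * 1 ^ 2)))).
- intros x hx.
  apply (continuous_ext_loc _ (fun r => Rpower r (p + al) * f (Rpower r al * w r))).
  { exists (mkposreal x hx); intros y hy; apply Rabs_def2 in hy.
    unfold minus, plus, opp in hy; simpl in hy.
    unfold flux_density; destruct (Rlt_dec 0 y) as [_|h]; [reflexivity|lra]. }
  apply (continuous_mult (K := R_AbsRing)); [apply Rpower_continuous, hx|].
  apply (continuous_comp (fun r => Rpower r al * w r) f);
    [|apply (lipschitz_continuous K); assumption].
  apply (continuous_mult (K := R_AbsRing)); [apply Rpower_continuous, hx|apply hc, hx].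
- intros x hx; unfold flux_density; destruct (Rlt_dec 0 x); [lra|reflexivity].
- intros x hx.
  assert (h := flux_density_diff p al K f w (fun _ => 0) x hf ltac:(lra)).
  rewrite flux_density_zero, !Rminus_0_r in h by exact hf0.
  apply Rle_trans with (1 := h); rewrite Rmult_comm.
  apply Rmult_le_compat; [apply Rmult_le_pos; [lra|apply Rabs_pos]|left; apply Rpower_pos| |
    apply Rpower_le_id; lra].
  apply Rmult_le_compat_l; [lra|].
  apply Rle_trans with (1 := hb x ltac:(lra)).
  apply Rmult_le_compat_l; [exact hA|apply exp_sq_le; lra].
Qed.

Lemma continuous_ex_RInt (g : R -> R) (x y : R) : (forall t, continuous g t) -> ex_RInt g x y.
Proof.
intros hg; apply (ex_RInt_continuous (V := R_CompleteNormedModule)); intros; apply hg.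
Qed.

(** The integrand is bounded with the power taken at the right end [r]; division cancels that power
    and leaves the length of the interval. *)
Lemma slope_diff (p al K A B : R) (f w w' : R -> R) (r D : R) :
  0 < K -> lipschitz K f -> f 0 = 0 -> 1 <= p + 2 * al ->
  admissible K A w -> admissible K B w' -> 0 < r ->
  (forall x, 0 < x <= r -> Rabs (w x - w' x) <= D) ->
  Rabs (slope p al f w r - slope p al f w' r) <= K * D * r.
Proof.
intros hK hf hf0 hm hw hw' hr hD.
assert (hi := flux_density_continuous p al K A f w hK hf hf0 hm hw).
assert (hi' := flux_density_continuous p al K B f w' hK hf hf0 hm hw').
unfold slope; destruct (Rlt_dec 0 r) as [_|h]; [|lra].
set (P := Rpower r (p + 2 * al)); assert (hP : 0 < P) by apply Rpower_pos.
assert (hD0 : 0 <= D).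
{ specialize (hD r ltac:(lra)); assert (h := Rabs_pos (w r - w' r)); lra. }
replace (RInt (flux_density p al f w) 0 r / P - RInt (flux_density p al f w') 0 r / P)
  with (RInt (fun x => flux_density p al f w x - flux_density p al f w' x) 0 r / P).
- unfold Rdiv; rewrite Rabs_mult, (Rabs_pos_eq (/ P)) by (left; apply Rinv_0_lt_compat, hP).
  apply (Rmult_le_reg_r P); [exact hP|].
  rewrite Rmult_assoc, Rinv_l, Rmult_1_r by lra.
  replace (K * D * r * P) with ((r - 0) * (P * (K * D))) by ring.
  apply abs_RInt_le_const; [lra| |].
  + apply continuous_ex_RInt; intros t.
    apply (continuous_minus (V := R_NormedModule)); [apply hi|apply hi'].
  + intros t [ht0 htr]; destruct ht0 as [ht0|<-].
    * apply Rle_trans with (1 := flux_density_diff p al K f w w' t hf ht0).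
      apply Rmult_le_compat; [left; apply Rpower_pos| | |].
      -- apply Rmult_le_pos; [lra|apply Rabs_pos].
      -- apply Rle_Rpower_l; lra.
      -- apply Rmult_le_compat_l; [lra|apply hD; lra].
    * unfold flux_density; destruct (Rlt_dec 0 0) as [h|_]; [lra|].
      rewrite Rminus_0_r, Rabs_R0; apply Rmult_le_pos; [lra|apply Rmult_le_pos; lra].
- rewrite (RInt_minus (V := R_CompleteNormedModule)); try (apply continuous_ex_RInt; assumption).
  unfold minus, plus, opp; simpl; field; lra.
Qed.

Lemma slope_zero (p al : R) (f : R -> R) (r : R) : f 0 = 0 -> slope p al f (fun _ => 0) r = 0.
Proof.
intros hf; unfold slope; destruct (Rlt_dec 0 r) as [_|_]; [|reflexivity].
rewrite (RInt_ext _ (fun _ => 0)) by (intros; apply flux_density_zero, hf).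
rewrite RInt_const; unfold scal; simpl; unfold mult; simpl; field.
apply Rgt_not_eq, Rpower_pos.
Qed.

Lemma admissible_zero (K : R) : admissible K 0 (fun _ => 0).
Proof.
split; intros x _; [apply continuous_const|rewrite Rabs_R0; lra].
Qed.

Lemma slope_bound (p al K A : R) (f w : R -> R) (r D : R) :
  0 < K -> lipschitz K f -> f 0 = 0 -> 1 <= p + 2 * al -> admissible K A w -> 0 < r ->
  (forall x, 0 < x <= r -> Rabs (w x) <= D) -> Rabs (slope p al f w r) <= K * D * r.
Proof.
intros hK hf hf0 hm hw hr hD.
rewrite <- (Rminus_0_r (slope p al f w r)), <- (slope_zero p al f r hf0).
apply (slope_diff p al K A 0); auto; [apply admissible_zero|].
intros x hx; rewrite Rminus_0_r; auto.
Qed.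

Lemma is_derive_slope (p al K A : R) (f w : R -> R) (r : R) :
  0 < K -> lipschitz K f -> f 0 = 0 -> 1 <= p + 2 * al -> admissible K A w -> 0 < r ->
  is_derive (slope p al f w) r
    (f (Rpower r al * w r) / Rpower r al - (p + 2 * al) / r * slope p al f w r).
Proof.
intros hK hf hf0 hm hw hr.
assert (hi := flux_density_continuous p al K A f w hK hf hf0 hm hw).
assert (hpos : forall x, Rpower x (p + 2 * al) <> 0) by (intros; apply Rgt_not_eq, Rpower_pos).
apply (is_derive_ext_loc (fun r => RInt (flux_density p al f w) 0 r * Rpower r (- (p + 2 * al)))).
{ exists (mkposreal r hr); intros y hy; apply Rabs_def2 in hy.
  unfold minus, plus, opp in hy; simpl in hy.
  unfold slope; destruct (Rlt_dec 0 y) as [_|h]; [|lra].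
  rewrite Rpower_Ropp; reflexivity. }
replace (f (Rpower r al * w r) / Rpower r al - (p + 2 * al) / r * slope p al f w r)
  with (flux_density p al f w r * Rpower r (- (p + 2 * al))
    + RInt (flux_density p al f w) 0 r
      * (- (p + 2 * al) / r * Rpower r (- (p + 2 * al)))).
- apply (is_derive_Rmult (RInt (flux_density p al f w) 0) (fun r => Rpower r (- (p + 2 * al))));
    [|apply is_derive_Rpower, hr].
  apply is_derive_primitive, hi.
- unfold slope, flux_density at 1; destruct (Rlt_dec 0 r) as [_|h]; [|lra].
  rewrite Rpower_Ropp; replace (p + 2 * al) with ((p + al) + al) at 1 by ring.
  rewrite (Rpower_plus (p + al) al); field.
  repeat split; try (apply Rgt_not_eq, Rpower_pos); lra.
Qed.

Lemma slope_continuous (p al K A : R) (f w : R -> R) :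
  0 < K -> lipschitz K f -> f 0 = 0 -> 1 <= p + 2 * al -> admissible K A w ->
  forall x, continuous (slope p al f w) x.
Proof.
intros hK hf hf0 hm hw.
apply (continuous_glue_zero _ (K * (A * exp (K * 1 ^ 2)))).
- intros x hx; exact (is_derive_continuous _ _ _ (is_derive_slope p al K A f w x hK hf hf0 hm hw hx)).
- intros x hx; unfold slope; destruct (Rlt_dec 0 x); [lra|reflexivity].
- intros x hx; apply (slope_bound p al K A); auto; try lra.
  intros y hy; apply Rle_trans with (1 := proj2 hw y ltac:(lra)).
  apply Rmult_le_compat_l; [exact (admissible_nonneg K A w hw)|apply exp_sq_le; lra].
Qed.

Lemma is_derive_profile_step (p al K A : R) (f w : R -> R) (c r : R) :
  0 < K -> lipschitz K f -> f 0 = 0 -> 1 <= p + 2 * al -> admissible K A w ->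
  is_derive (profile_step p al f c w) r (slope p al f w r).
Proof.
intros hK hf hf0 hm hw; unfold profile_step.
replace (slope p al f w r) with (plus 0 (slope p al f w r)) by (unfold plus; simpl; ring).
apply (is_derive_plus (V := R_NormedModule)); [apply (is_derive_const (V := R_NormedModule))|].
apply (is_derive_primitive (slope p al f w)), (slope_continuous p al K A); assumption.
Qed.

(* The weight exp(K r^2) turns the step into a contraction of ratio 1/2. *)
Lemma profile_step_contracts (p al K A B D : R) (f w w' : R -> R) (c c' r : R) :
  0 < K -> lipschitz K f -> f 0 = 0 -> 1 <= p + 2 * al ->
  admissible K A w -> admissible K B w' -> 0 < r ->
  (forall x, 0 < x -> Rabs (w x - w' x) <= D * exp (K * x ^ 2)) ->
  Rabs (profile_step p al f c w r - profile_step p al f c' w' r)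
  <= Rabs (c - c') + D / 2 * (exp (K * r ^ 2) - 1).
Proof.
intros hK hf hf0 hm hw hw' hr hD.
assert (hD0 : 0 <= D).
{ specialize (hD 1 ltac:(lra)); assert (h1 := Rabs_pos (w 1 - w' 1)).
  assert (h2 := exp_pos (K * 1 ^ 2)); nra. }
set (g := fun r => profile_step p al f c w r - profile_step p al f c' w' r).
assert (h0 : g 0 = c - c').
{ unfold g, profile_step; rewrite !RInt_point; unfold zero; simpl; ring. }
(* The bound from [slope_diff], K D r exp(K r^2), is the exact derivative of (D / 2) exp(K r^2);
   this is the origin of the ratio 1/2. *)
assert (hg : Rabs (g r - g 0) <= D / 2 * exp (K * r ^ 2) - D / 2 * exp (K * 0 ^ 2)).
{ apply (derive_dominated g (fun r => D / 2 * exp (K * r ^ 2))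
    (fun r => slope p al f w r - slope p al f w' r)
    (fun r => K * (D * exp (K * r ^ 2)) * r)); [lra| | |].
  - intros x _; apply (is_derive_minus (V := R_NormedModule)).
    + apply (is_derive_profile_step p al K A); assumption.
    + apply (is_derive_profile_step p al K B); assumption.
  - intros x _; auto_derive; [easy|]; simpl; field.
  - intros x [[hx|<-] _].
    + apply (slope_diff p al K A B); auto.
      intros y hy; apply Rle_trans with (1 := hD y ltac:(lra)).
      apply Rmult_le_compat_l; [exact hD0|apply exp_sq_le; lra].
    + unfold slope; destruct (Rlt_dec 0 0) as [h|_]; [lra|].
      rewrite Rminus_0_r, Rabs_R0; lra. }
replace (K * 0 ^ 2) with 0 in hg by ring; rewrite exp_0 in hg.
change (profile_step p al f c w r - profile_step p al f c' w' r) with (g r).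
replace (g r) with ((g r - g 0) + (c - c')) by (rewrite h0; ring).
apply Rle_trans with (1 := Rabs_triang _ _); lra.
Qed.

Lemma profile_step_zero (p al : R) (f : R -> R) (c r : R) : f 0 = 0 ->
  profile_step p al f c (fun _ => 0) r = c.
Proof.
intros hf; unfold profile_step.
rewrite (RInt_ext _ (fun _ => 0)) by (intros; apply slope_zero, hf).
rewrite RInt_const; unfold scal; simpl; unfold mult; simpl; ring.
Qed.

Lemma profile_step_bound (p al K A : R) (f w : R -> R) (c r : R) :
  0 < K -> lipschitz K f -> f 0 = 0 -> 1 <= p + 2 * al -> admissible K A w -> 0 < r ->
  Rabs (profile_step p al f c w r - c) <= A / 2 * (exp (K * r ^ 2) - 1).
Proof.
intros hK hf hf0 hm hw hr.
rewrite <- (profile_step_zero p al f c r hf0) at 2.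
apply Rle_trans with (Rabs (c - c) + A / 2 * (exp (K * r ^ 2) - 1)).
- apply (profile_step_contracts p al K A 0); auto; [apply admissible_zero|].
  intros x hx; rewrite Rminus_0_r; apply hw, hx.
- rewrite Rminus_diag, Rabs_R0; lra.
Qed.

(** * Picard iterates and their limit *)

Fixpoint picard (p al : R) (f : R -> R) (c : R) (n : nat) : R -> R :=
  match n with
  | O => fun _ => c
  | S k => profile_step p al f c (picard p al f c k)
  end.

Lemma exp_sq_ge_1 (K r : R) : 0 < K -> 1 <= exp (K * r ^ 2).
Proof.
intros hK; assert (h := exp_ineq1_le (K * r ^ 2)).
assert (0 <= K * r ^ 2) by (apply Rmult_le_pos; [lra|apply pow2_ge_0]); lra.
Qed.

Lemma picard_admissible (p al K : R) (f : R -> R) (c : R) (n : nat) :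
  0 < K -> lipschitz K f -> f 0 = 0 -> 1 <= p + 2 * al ->
  admissible K (2 * Rabs c) (picard p al f c n).
Proof.
intros hK hf hf0 hm; assert (hc := Rabs_pos c); induction n as [|n IH]; simpl; split; intros x hx.
- apply continuous_const.
- assert (h := exp_sq_ge_1 K x hK); nra.
- apply (is_derive_continuous _ x (slope p al f (picard p al f c n) x)).
  apply (is_derive_profile_step p al K (2 * Rabs c)); assumption.
- assert (h := profile_step_bound p al K _ f _ c x hK hf hf0 hm IH hx).
  assert (h1 := exp_sq_ge_1 K x hK).
  set (y := profile_step p al f c (picard p al f c n) x) in *.
  replace y with ((y - c) + c) by ring.
  apply Rle_trans with (1 := Rabs_triang _ _).
  change (x * (x * 1)) with (x ^ 2); nra.
Qed.

Lemma picard_increment (p al K : R) (f : R -> R) (c : R) (n : nat) :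
  0 < K -> lipschitz K f -> f 0 = 0 -> 1 <= p + 2 * al -> forall r, 0 < r ->
  Rabs (picard p al f c (S n) r - picard p al f c n r) <= Rabs c * (1 / 2) ^ n * exp (K * r ^ 2).
Proof.
intros hK hf hf0 hm; assert (hc := Rabs_pos c); induction n as [|n IH]; intros r hr.
- simpl picard.
  assert (h := profile_step_bound p al K _ f _ c r hK hf hf0 hm
    (picard_admissible p al K f c 0 hK hf hf0 hm) hr).
  simpl picard in h; assert (h1 := exp_sq_ge_1 K r hK).
  rewrite pow_O; nra.
- assert (h := profile_step_contracts p al K _ _ (Rabs c * (1 / 2) ^ n) f _ _ c c r hK hf hf0 hm
    (picard_admissible p al K f c (S n) hK hf hf0 hm)
    (picard_admissible p al K f c n hK hf hf0 hm) hr IH).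
  change (profile_step p al f c (picard p al f c (S n)) r) with (picard p al f c (S (S n)) r) in h.
  change (profile_step p al f c (picard p al f c n) r) with (picard p al f c (S n) r) in h.
  rewrite Rminus_diag, Rabs_R0 in h.
  assert (h2 : 0 <= (1 / 2) ^ n) by (apply pow_le; lra).
  assert (h3 : 0 <= Rabs c * (1 / 2) ^ n) by (apply Rmult_le_pos; assumption).
  change ((1 / 2) ^ S n) with (1 / 2 * (1 / 2) ^ n); lra.
Qed.

Lemma picard_lipschitz (p al K : R) (f : R -> R) (c d : R) (n : nat) :
  0 < K -> lipschitz K f -> f 0 = 0 -> 1 <= p + 2 * al -> forall r, 0 < r ->
  Rabs (picard p al f c n r - picard p al f d n r) <= 2 * Rabs (c - d) * exp (K * r ^ 2).
Proof.
intros hK hf hf0 hm; assert (hc := Rabs_pos (c - d)); induction n as [|n IH]; intros r hr.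
- simpl picard; assert (h1 := exp_sq_ge_1 K r hK); nra.
- assert (h := profile_step_contracts p al K _ _ _ f _ _ c d r hK hf hf0 hm
    (picard_admissible p al K f c n hK hf hf0 hm)
    (picard_admissible p al K f d n hK hf hf0 hm) hr IH).
  change (profile_step p al f c (picard p al f c n) r) with (picard p al f c (S n) r) in h.
  change (profile_step p al f d (picard p al f d n) r) with (picard p al f d (S n) r) in h.
  assert (h1 := exp_sq_ge_1 K r hK); nra.
Qed.

(** The increments telescope to 2 B ((1/2)^n - (1/2)^(n+k)); keeping the subtracted term is what
    lets the induction on k close. *)
Lemma geometric_limit (a : nat -> R) (B : R) :
  (forall n, Rabs (a (S n) - a n) <= B * (1 / 2) ^ n) ->
  is_lim_seq a (real (Lim_seq a)) /\
  forall n, Rabs (real (Lim_seq a) - a n) <= 2 * B * (1 / 2) ^ n.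
Proof.
intros h.
assert (hgap : forall n k, Rabs (a (n + k)%nat - a n) <= 2 * B * ((1 / 2) ^ n - (1 / 2) ^ (n + k))).
{ intros n k; induction k as [|k IH].
  - rewrite Nat.add_0_r, !Rminus_diag, Rabs_R0; lra.
  - rewrite Nat.add_succ_r.
    replace (a (S (n + k)) - a n) with ((a (S (n + k)) - a (n + k)%nat) + (a (n + k)%nat - a n)) by ring.
    apply Rle_trans with (1 := Rabs_triang _ _).
    specialize (h (n + k)%nat); simpl pow; lra. }
assert (hB : 0 <= B).
{ specialize (h 0%nat); rewrite pow_O in h; assert (h1 := Rabs_pos (a 1%nat - a 0%nat)); lra. }
assert (hgap' : forall n k, Rabs (a (n + k)%nat - a n) <= 2 * B * (1 / 2) ^ n).
{ intros n k; apply Rle_trans with (1 := hgap n k).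
  apply Rmult_le_compat_l; [lra|].
  assert (h1 : 0 <= (1 / 2) ^ (n + k)) by (apply pow_le; lra); lra. }
assert (hc : Cauchy_crit a).
{ intros eps heps.
  destruct (pow_lt_1_zero (1 / 2) ltac:(rewrite Rabs_pos_eq; lra) (eps / (4 * B + 1))) as [N HN].
  { apply Rdiv_lt_0_compat; lra. }
  specialize (HN N (le_n N)); rewrite Rabs_pos_eq in HN by (apply pow_le; lra).
  assert (hN : 2 * (2 * B * (1 / 2) ^ N) < eps).
  { apply (Rmult_lt_compat_l (4 * B + 1)) in HN; [|lra].
    replace ((4 * B + 1) * (eps / (4 * B + 1))) with eps in HN by (field; lra).
    assert (h1 : 0 <= (1 / 2) ^ N) by (apply pow_le; lra); lra. }
  exists N; intros i j hi hj; unfold Rdist.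
  replace i with (N + (i - N))%nat by lia; replace j with (N + (j - N))%nat by lia.
  assert (h1 := hgap' N (i - N)%nat); assert (h2 := hgap' N (j - N)%nat).
  set (y := a (N + (i - N))%nat) in *; set (z := a (N + (j - N))%nat) in *.
  replace (y - z) with ((y - a N) + - (z - a N)) by ring.
  apply Rle_lt_trans with (1 := Rabs_triang _ _); rewrite Rabs_Ropp; lra. }
destruct (Rcomplete.R_complete a hc) as [l hl].
apply is_lim_seq_Reals in hl; rewrite (is_lim_seq_unique a l hl); simpl.
split; [exact hl|]; intros n.
apply is_lim_seq_Reals in hl.
apply le_epsilon; intros eps heps.
destruct (hl eps heps) as [N HN]; specialize (HN (n + N)%nat ltac:(lia)); unfold Rdist in HN.
specialize (hgap' n N).
replace (l - a n) with (- (a (n + N)%nat - l) + (a (n + N)%nat - a n)) by ring.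
apply Rle_trans with (1 := Rabs_triang _ _); rewrite Rabs_Ropp; lra.
Qed.

Definition profile (p al : R) (f : R -> R) (c r : R) : R :=
  real (Lim_seq (fun n => picard p al f c n r)).

Lemma profile_near_picard (p al K : R) (f : R -> R) (c r : R) (n : nat) :
  0 < K -> lipschitz K f -> f 0 = 0 -> 1 <= p + 2 * al -> 0 < r ->
  Rabs (profile p al f c r - picard p al f c n r)
  <= 2 * Rabs c * (1 / 2) ^ n * exp (K * r ^ 2).
Proof.
intros hK hf hf0 hm hr.
destruct (geometric_limit (fun n => picard p al f c n r) (Rabs c * exp (K * r ^ 2))) as [_ h].
- intros k; assert (h := picard_increment p al K f c k hK hf hf0 hm r hr); lra.
- specialize (h n); unfold profile; lra.
Qed.

Lemma half_pow_small (C eps : R) : 0 <= C -> 0 < eps -> exists n : nat, C * (1 / 2) ^ n < eps.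
Proof.
intros hC heps.
destruct (pow_lt_1_zero (1 / 2) ltac:(rewrite Rabs_pos_eq; lra) (eps / (C + 1))) as [N HN].
{ apply Rdiv_lt_0_compat; lra. }
specialize (HN N (le_n N)); rewrite Rabs_pos_eq in HN by (apply pow_le; lra).
exists N; apply (Rmult_lt_compat_l (C + 1)) in HN; [|lra].
replace ((C + 1) * (eps / (C + 1))) with eps in HN by (field; lra).
assert (h1 : 0 <= (1 / 2) ^ N) by (apply pow_le; lra); lra.
Qed.

Lemma profile_lipschitz (p al K : R) (f : R -> R) (c d r : R) :
  0 < K -> lipschitz K f -> f 0 = 0 -> 1 <= p + 2 * al -> 0 < r ->
  Rabs (profile p al f c r - profile p al f d r) <= 2 * Rabs (c - d) * exp (K * r ^ 2).
Proof.
intros hK hf hf0 hm hr; apply le_epsilon; intros eps heps.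
assert (hc := Rabs_pos c); assert (hd := Rabs_pos d); assert (he := exp_pos (K * r ^ 2)).
destruct (half_pow_small ((2 * Rabs c + 2 * Rabs d) * exp (K * r ^ 2)) eps) as [n hn]; auto.
{ apply Rmult_le_pos; lra. }
assert (h1 := profile_near_picard p al K f c r n hK hf hf0 hm hr).
assert (h2 := profile_near_picard p al K f d r n hK hf hf0 hm hr).
assert (h3 := picard_lipschitz p al K f c d n hK hf hf0 hm r hr).
apply Rabs_le_between in h1; apply Rabs_le_between in h2; apply Rabs_le_between in h3.
apply Rabs_le; lra.
Qed.

(** Convergence is uniform on (0, 2 x], so continuity at x passes to the limit. The growth bound
    compares with amplitude 0, whose profile vanishes. *)
Lemma profile_admissible (p al K : R) (f : R -> R) (c : R) :
  0 < K -> lipschitz K f -> f 0 = 0 -> 1 <= p + 2 * al ->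
  admissible K (2 * Rabs c) (profile p al f c).
Proof.
intros hK hf hf0 hm; assert (hc := Rabs_pos c); split.
- intros x hx; apply continuous_eps; intros eps heps.
  assert (he := exp_pos (K * (2 * x) ^ 2)).
  destruct (half_pow_small (2 * Rabs c * exp (K * (2 * x) ^ 2)) (eps / 3)) as [n hn]; [|lra|].
  { apply Rmult_le_pos; lra. }
  assert (hclose : forall y, 0 < y <= 2 * x ->
    Rabs (profile p al f c y - picard p al f c n y) < eps / 3).
  { intros y hy.
    apply Rle_lt_trans with (1 := profile_near_picard p al K f c y n hK hf hf0 hm (proj1 hy)).
    apply Rle_lt_trans with (2 := hn).
    assert (h1 : 0 <= (1 / 2) ^ n) by (apply pow_le; lra).
    assert (h2 := exp_sq_le K y (2 * x) hK ltac:(lra)).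
    replace (2 * Rabs c * exp (K * (2 * x) ^ 2) * (1 / 2) ^ n)
      with (2 * Rabs c * (1 / 2) ^ n * exp (K * (2 * x) ^ 2)) by ring.
    apply Rmult_le_compat_l; [|exact h2]; apply Rmult_le_pos; lra. }
  destruct (picard_admissible p al K f c n hK hf hf0 hm) as [hcont _].
  destruct (proj1 (continuous_eps _ x) (hcont x hx) (eps / 3) ltac:(lra)) as [d [hd H]].
  assert (h1 := Rmin_l x d); assert (h2 := Rmin_r x d).
  exists (Rmin x d); split; [apply Rmin_pos; lra|].
  intros y hy; specialize (H y ltac:(lra)); apply Rabs_def2 in hy.
  assert (h3 := hclose y ltac:(lra)); assert (h4 := hclose x ltac:(lra)).
  apply Rabs_def2 in H; apply Rabs_def2 in h3; apply Rabs_def2 in h4.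
  apply Rabs_def1; lra.
- intros x hx.
  assert (h := profile_lipschitz p al K f c 0 x hK hf hf0 hm hx).
  assert (hz := profile_near_picard p al K f 0 x 0 hK hf hf0 hm hx).
  simpl picard in hz; rewrite Rabs_R0, Rminus_0_r in hz.
  rewrite Rmult_0_r, !Rmult_0_l in hz.
  assert (hz' : profile p al f 0 x = 0).
  { apply Rabs_le_between in hz; lra. }
  rewrite hz', !Rminus_0_r in h; exact h.
Qed.

(** The iterate of index n + 1 lies within a multiple of (1/2)^n of both sides: of the limit by
    convergence, of its step by contraction. *)
Lemma profile_fixed (p al K : R) (f : R -> R) (c r : R) :
  0 < K -> lipschitz K f -> f 0 = 0 -> 1 <= p + 2 * al -> 0 < r ->
  profile p al f c r = profile_step p al f c (profile p al f c) r.
Proof.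
intros hK hf hf0 hm hr; assert (hc := Rabs_pos c).
apply Rminus_diag_uniq, Rabs_eq_0, Rle_antisym; [|apply Rabs_pos].
apply le_epsilon; intros eps heps; rewrite Rplus_0_l.
assert (he := exp_pos (K * r ^ 2)).
destruct (half_pow_small (3 * Rabs c * exp (K * r ^ 2)) eps) as [n hn]; auto.
{ apply Rmult_le_pos; lra. }
assert (h1 := profile_near_picard p al K f c r (S n) hK hf hf0 hm hr).
assert (h2 := profile_step_contracts p al K _ _ (2 * Rabs c * (1 / 2) ^ n) f _ _ c c r hK hf hf0 hm
  (profile_admissible p al K f c hK hf hf0 hm) (picard_admissible p al K f c n hK hf hf0 hm) hr).
rewrite Rminus_diag, Rabs_R0 in h2.
specialize (h2 (fun x hx => profile_near_picard p al K f c x n hK hf hf0 hm hx)).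
change (profile_step p al f c (picard p al f c n) r) with (picard p al f c (S n) r) in h2.
change ((1 / 2) ^ S n) with (1 / 2 * (1 / 2) ^ n) in h1.
assert (h3 : 0 <= (1 / 2) ^ n) by (apply pow_le; lra).
assert (h4 : 0 <= Rabs c * (1 / 2) ^ n) by (apply Rmult_le_pos; assumption).
assert (h5 : 0 <= Rabs c * (1 / 2) ^ n * exp (K * r ^ 2)) by (apply Rmult_le_pos; lra).
apply Rabs_le_between in h1; apply Rabs_le_between in h2.
apply Rabs_le; lra.
Qed.

Lemma is_derive_profile (p al K : R) (f : R -> R) (c r : R) :
  0 < K -> lipschitz K f -> f 0 = 0 -> 1 <= p + 2 * al -> 0 < r ->
  is_derive (profile p al f c) r (slope p al f (profile p al f c) r).
Proof.
intros hK hf hf0 hm hr.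
apply (is_derive_ext_loc (profile_step p al f c (profile p al f c))).
- exists (mkposreal r hr); intros y hy; apply Rabs_def2 in hy.
  unfold minus, plus, opp in hy; simpl in hy.
  symmetry; apply (profile_fixed p al K); auto; lra.
- apply (is_derive_profile_step p al K (2 * Rabs c)); auto.
  apply profile_admissible; assumption.
Qed.

(** The interface between the integral equation and the shooting argument. The last clause lets
    large amplitudes pass any level before [r]; Lipschitz dependence of the derivative serves to
    make the energy of small shots small. *)
Lemma shooting_family (p q al K : R) (f : R -> R) :
  0 < al -> 1 <= p + 2 * al -> al * al + (p - 1) * al = q ->
  0 < K -> lipschitz K f -> f 0 = 0 ->
  exists U U1 : R -> R -> R,
    (forall c, ode p q f p_infty (U c) (U1 c)) /\
    (forall c, tends_at_zero (U c)) /\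
    (forall r, 0 < r -> exists B, 0 < B /\ forall c d,
       Rabs (U c r - U d r) <= B * Rabs (c - d) /\
       Rabs (U1 c r - U1 d r) <= B * Rabs (c - d)) /\
    (forall r, 0 < r -> U 0 r = 0 /\ U1 0 r = 0) /\
    (forall r, 0 < r -> exists x k, 0 < x < r /\ 0 < k /\ forall c, 0 <= c -> k * c <= U c x).
Proof.
intros hal hm hq hK hf hf0.
set (W := profile p al f); set (J := fun c => slope p al f (W c)).
set (U := fun c r => Rpower r al * W c r).
set (U1 := fun c r => al / r * Rpower r al * W c r + Rpower r al * J c r).
assert (hadm : forall c, admissible K (2 * Rabs c) (W c)).
{ intros c; apply profile_admissible; assumption. }
assert (hLip : forall r, 0 < r -> exists B, 0 < B /\ forall c d,
   Rabs (U c r - U d r) <= B * Rabs (c - d) /\ Rabs (U1 c r - U1 d r) <= B * Rabs (c - d)).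
{ intros r hr; set (E := 2 * exp (K * r ^ 2)).
  assert (hE : 0 < E) by (unfold E; assert (h := exp_pos (K * r ^ 2)); lra).
  set (P := Rpower r al); assert (hP : 0 < P) by apply Rpower_pos.
  assert (har : 0 < al / r) by (apply Rdiv_lt_0_compat; assumption).
  assert (hPE : 0 < P * E) by (apply Rmult_lt_0_compat; assumption).
  assert (h1 : 0 < al / r * (P * E)) by (apply Rmult_lt_0_compat; assumption).
  assert (h2 : 0 < P * (K * E * r)) 
    by (apply Rmult_lt_0_compat; [|apply Rmult_lt_0_compat; [apply Rmult_lt_0_compat|]]; assumption).
  exists (P * E + al / r * (P * E) + P * (K * E * r)); split; [lra|].
  intros c d; assert (hcd := Rabs_pos (c - d)).
  assert (hW : forall x, 0 < x <= r -> Rabs (W c x - W d x) <= E * Rabs (c - d)).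
  { intros x hx; apply Rle_trans with (1 := profile_lipschitz p al K f c d x hK hf hf0 hm (proj1 hx)).
    assert (h := exp_sq_le K x r hK ltac:(lra)); unfold E; nra. }
  assert (hJ : Rabs (J c r - J d r) <= K * (E * Rabs (c - d)) * r).
  { exact (slope_diff p al K _ _ f _ _ r _ hK hf hf0 hm (hadm c) (hadm d) hr hW). }
  assert (hWr := hW r ltac:(lra)).
  assert (hPW : Rabs (P * W c r - P * W d r) <= P * E * Rabs (c - d)).
  { rewrite <- Rmult_minus_distr_l, Rabs_mult, (Rabs_pos_eq P) by lra.
    rewrite Rmult_assoc; apply Rmult_le_compat_l; lra. }
  split; unfold U, U1; fold P.
  - apply Rle_trans with (1 := hPW); nra.
  - replace (al / r * P * W c r + P * J c r - (al / r * P * W d r + P * J d r))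
      with (al / r * (P * W c r - P * W d r) + P * (J c r - J d r)) by ring.
    apply Rle_trans with (1 := Rabs_triang _ _).
    rewrite !Rabs_mult, (Rabs_pos_eq (al / r)), (Rabs_pos_eq P) by lra.
    apply (Rmult_le_compat_l (al / r)) in hPW; [|lra].
    apply (Rmult_le_compat_l P) in hJ; [|lra].
    assert (0 <= P * E * Rabs (c - d)) by (apply Rmult_le_pos; lra); lra. }
exists U, U1; split; [|split; [|split; [exact hLip|split]]].
- intros c r [hr _].
  assert (hW := is_derive_profile p al K f c r hK hf hf0 hm hr).
  assert (hJ := is_derive_slope p al K _ f _ r hK hf hf0 hm (hadm c) hr).
  fold (W c) in hW; fold (J c) in hW, hJ.
  assert (hP := is_derive_Rpower al r hr); assert (hP0 := Rpower_pos r al).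
  split.
  + exact (is_derive_Rmult _ _ r _ _ hP hW).
  + replace (f (U c r) - p / r * U1 c r + q / r ^ 2 * U c r) with
      (((- al / r ^ 2 * Rpower r al + al / r * (al / r * Rpower r al)) * W c r
        + al / r * Rpower r al * J c r)
       + (al / r * Rpower r al * J c r
         + Rpower r al * (f (Rpower r al * W c r) / Rpower r al - (p + 2 * al) / r * J c r))).
    * apply (is_derive_plus (V := R_NormedModule) (fun r => al / r * Rpower r al * W c r)
        (fun r => Rpower r al * J c r)).
      -- apply (is_derive_Rmult (fun r => al / r * Rpower r al) (W c)); [|exact hW].
         apply (is_derive_Rmult (fun r => al / r) (fun r => Rpower r al)); [|exact hP].
         auto_derive; [lra|field; lra].
      -- exact (is_derive_Rmult _ _ r _ _ hP hJ).
    (* Multiplying by r^al turns the equation for w into the original one precisely because [al] is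
       an indicial root. *)
    * unfold U, U1; rewrite <- hq; field; lra.
- intros c eps heps.
  set (C := 2 * Rabs c * exp (K * 1 ^ 2)).
  assert (hC : 0 <= C).
  { apply Rmult_le_pos; [assert (h := Rabs_pos c); lra|left; apply exp_pos]. }
  destruct (Rpower_tends_at_zero al C hal hC eps heps) as [d [hd H]].
  assert (h1 := Rmin_l 1 d); assert (h2 := Rmin_r 1 d).
  exists (Rmin 1 d); split; [apply Rmin_pos; lra|].
  intros r hr; apply Rle_lt_trans with (2 := H r ltac:(lra)).
  unfold U; assert (hP := Rpower_pos r al).
  rewrite Rabs_mult, (Rabs_pos_eq (Rpower r al)), Rmult_comm by lra.
  apply Rmult_le_compat_r; [lra|].
  apply Rle_trans with (1 := proj2 (hadm c) r ltac:(lra)).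
  apply Rmult_le_compat_l; [assert (h := Rabs_pos c); lra|apply exp_sq_le; lra].
- intros r hr.
  assert (hW : forall x, 0 < x -> W 0 x = 0).
  { intros x hx; assert (h := proj2 (hadm 0) x hx).
    rewrite Rabs_R0, Rmult_0_r, Rmult_0_l in h; apply Rabs_le_between in h; lra. }
  assert (hJ : Rabs (J 0 r) <= K * 0 * r).
  { apply (slope_bound p al K _ f _ r 0 hK hf hf0 hm (hadm 0) hr).
    intros x hx; rewrite hW, Rabs_R0; lra. }
  rewrite Rmult_0_r, Rmult_0_l in hJ; apply Rabs_le_between in hJ.
  assert (hJ0 : J 0 r = 0) by lra.
  unfold U, U1; rewrite hW, hJ0 by exact hr; split; ring.
- intros r hr.
  assert (hexp : continuous (fun x => exp (K * x ^ 2)) 0).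
  { apply (ex_derive_continuous (fun x => exp (K * x ^ 2))); auto_derive; easy. }
  (* Where exp(K x^2) < 3/2, [profile_step_bound] with A = 2 c gives |W c x - c| <= c / 2. *)
  destruct (proj1 (continuous_eps _ 0) hexp (1 / 2) ltac:(lra)) as [d [hd H]].
  assert (h1 := Rmin_l r d); assert (h2 := Rmin_r r d).
  assert (h0 : 0 < Rmin r d) by (apply Rmin_pos; assumption).
  set (x := Rmin r d / 2); assert (hx : 0 < x) by (unfold x; lra).
  exists x, (Rpower x al / 2); assert (hP := Rpower_pos x al).
  split; [unfold x; lra|]; split; [lra|]; intros c hc.
  specialize (H x); rewrite Rminus_0_r, Rabs_pos_eq in H by lra.
  specialize (H ltac:(unfold x; lra)).
  replace (K * 0 ^ 2) with 0 in H by ring; rewrite exp_0 in H; apply Rabs_def2 in H.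
  assert (hb := profile_step_bound p al K _ f _ c x hK hf hf0 hm (hadm c) hx).
  unfold W in hb; rewrite <- (profile_fixed p al K) in hb by assumption; fold (W c) in hb.
  rewrite (Rabs_pos_eq c) in hb by exact hc; apply Rabs_le_between in hb.
  assert (hWc : c / 2 <= W c x) by nra.
  unfold U; nra.
Qed.

(** * Shooting *)

(** Clamping the argument preserves the Lipschitz constant; with F 0 = F s = 0 the result vanishes
    outside [0, s], which supplies the sign conditions of both extremum principles. *)
Definition truncated (F : R -> R) (s t : R) : R := F (Rmax 0 (Rmin t s)).

Lemma truncated_in (F : R -> R) (s t : R) : 0 <= t <= s -> truncated F s t = F t.
Proof.
intros h; unfold truncated; rewrite Rmin_left, Rmax_right by lra; reflexivity.
Qed.

Lemma truncated_above (F : R -> R) (s t : R) : 0 <= s -> F s = 0 -> s <= t -> truncated F s t = 0.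
Proof.
intros hs h ht; unfold truncated; rewrite Rmin_right, Rmax_right by lra; exact h.
Qed.

Lemma truncated_below (F : R -> R) (s t : R) : 0 <= s -> F 0 = 0 -> t <= 0 -> truncated F s t = 0.
Proof.
intros hs h ht; unfold truncated; rewrite Rmin_left, Rmax_left by lra; exact h.
Qed.

Lemma truncated_lipschitz (K s : R) (F : R -> R) : 0 < K -> 0 <= s ->
  (forall t t', 0 <= t <= s -> 0 <= t' <= s -> Rabs (F t - F t') <= K * Rabs (t - t')) ->
  lipschitz K (truncated F s).
Proof.
intros hK hs hF t t'; unfold truncated.
apply Rle_trans with (1 := hF (Rmax 0 (Rmin t s)) (Rmax 0 (Rmin t' s))
  ltac:(unfold Rmax, Rmin; repeat destruct (Rle_dec _ _); lra)
  ltac:(unfold Rmax, Rmin; repeat destruct (Rle_dec _ _); lra)).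
apply Rmult_le_compat_l; [lra|].
unfold Rmax, Rmin; repeat destruct (Rle_dec _ _); unfold Rabs; repeat destruct (Rcase_abs _); lra.
Qed.

Lemma C1_lipschitz (F : R -> R) (s : R) : is_C1 F -> 0 <= s ->
  exists K, 0 < K /\
    forall t t', 0 <= t <= s -> 0 <= t' <= s -> Rabs (F t - F t') <= K * Rabs (t - t').
Proof.
intros hF hs.
destruct (continuity_ab_maj (fun t => Rabs (Derive F t)) 0 s hs) as [M [HM _]].
{ intros t _; apply continuous_continuity_pt.
  apply (continuous_comp (Derive F) Rabs); [apply hF|apply continuous_Rabs]. }
(* The added 1 keeps the constant positive. *)
exists (Rabs (Derive F M) + 1); assert (hK := Rabs_pos (Derive F M)); split; [lra|].
assert (hle : forall t t', 0 <= t -> t <= t' -> t' <= s ->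
  Rabs (F t' - F t) <= (Rabs (Derive F M) + 1) * (t' - t)).
{ intros t t' h0 htt hs'; rewrite Rmult_minus_distr_l.
  apply (derive_dominated F (fun x => (Rabs (Derive F M) + 1) * x) (Derive F)
    (fun _ => Rabs (Derive F M) + 1)); [exact htt| | |].
  - intros x _; apply Derive_correct, hF.
  - intros x _; auto_derive; [easy|ring].
  - intros x hx; specialize (HM x ltac:(lra)); simpl in HM; lra. }
intros t t' ht ht'; destruct (Rle_dec t t') as [h|h].
- rewrite (Rabs_minus_sym (F t)), (Rabs_minus_sym t), (Rabs_pos_eq (t' - t)) by lra.
  apply hle; lra.
- rewrite (Rabs_pos_eq (t - t')) by lra; apply hle; lra.
Qed.

Lemma C1_increasing_near (F : R -> R) (s : R) : is_C1 F -> 0 < Derive F s ->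
  exists eps, 0 < eps /\ forall t t', s - eps <= t -> t <= t' -> t' < s -> F t <= F t'.
Proof.
intros hF hd.
destruct (proj1 (continuous_eps _ s) (proj2 (hF s)) (Derive F s) hd) as [e [he H]].
exists (e / 2); split; [lra|]; intros t t' h1 h2 h3.
enough (- F t' <= - F t) by lra.
apply (derive_nonpos_le (fun x => - F x) (fun x => - Derive F x)); [exact h2| |].
- intros x _; apply (is_derive_opp (V := R_NormedModule)), Derive_correct, hF.
- intros x hx; specialize (H x ltac:(apply Rabs_def1; lra)); apply Rabs_def2 in H; lra.
Qed.

(** The larger root of the quadratic, with discriminant D; p + 2 al equals 1 + sqrt D, whence the
    last bound. *)
Lemma positive_indicial_root (p q : R) : 0 < q ->
  exists al, 0 < al /\ al * al + (p - 1) * al = q /\ 1 <= p + 2 * al.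
Proof.
intros hq; set (D := (p - 1) ^ 2 + 4 * q).
assert (hD : 0 < D) by (unfold D; assert (h := pow2_ge_0 (p - 1)); lra).
assert (hsq : sqrt D * sqrt D = D) by (apply sqrt_sqrt; lra).
assert (hs : 0 < sqrt D) by (apply sqrt_lt_R0, hD).
assert (hgt : p - 1 < sqrt D) by (unfold D in *; nra).
exists ((sqrt D - (p - 1)) / 2); split; [lra|]; split; [|lra].
assert (hD' : D = (p - 1) ^ 2 + 4 * q) by reflexivity; clearbody D; nra.
Qed.

(** Used mostly in contrapositive form: a shot that has exceeded [s] stays above it. The mirror
    statement for level 0 follows. *)
Lemma truncated_le_of_le (p q s : R) (F u u1 : R -> R) (r R0 : R) :
  0 < q -> 0 <= s -> F s = 0 -> ode p q (truncated F s) p_infty u u1 -> tends_at_zero u ->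
  u R0 <= s -> 0 < r <= R0 -> u r <= s.
Proof.
intros hq hs hF h h0 hR hr.
destruct (Req_dec r R0) as [-> |hne]; [exact hR|].
apply (maximum_principle p q (truncated F s) R0 u u1 s (u R0)); auto.
- apply (ode_restrict p q _ p_infty); [easy|exact h].
- apply tends_at_end_finite; [lra|].
  apply (ode_continuous p q (truncated F s) p_infty u u1); [exact h|split; [lra|easy]].
- intros t ht; rewrite truncated_above by lra; lra.
- apply dom_finite; lra.
Qed.

Lemma truncated_ge_of_ge (p q s : R) (F u u1 : R -> R) (r R0 : R) :
  0 < q -> 0 <= s -> F 0 = 0 -> ode p q (truncated F s) p_infty u u1 -> tends_at_zero u ->
  0 <= u R0 -> 0 < r <= R0 -> 0 <= u r.
Proof.
intros hq hs hF h h0 hR hr.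
destruct (Req_dec r R0) as [-> |hne]; [exact hR|].
apply (minimum_principle p q (truncated F s) R0 u u1 0 (u R0)); auto; try lra.
- apply (ode_restrict p q _ p_infty); [easy|exact h].
- apply tends_at_end_finite; [lra|].
  apply (ode_continuous p q (truncated F s) p_infty u u1); [exact h|split; [lra|easy]].
- intros t ht; rewrite truncated_below by lra; lra.
- apply dom_finite; lra.
Qed.

Lemma ode_truncated (p q s : R) (F : R -> R) (b : Rbar) (u u1 : R -> R) :
  ode p q (truncated F s) b u u1 -> (forall r, dom b r -> 0 <= u r <= s) -> ode p q F b u u1.
Proof.
intros h hbd r hr; destruct (h r hr) as [h1 h2]; split; [exact h1|].
rewrite (truncated_in F s (u r) (hbd r hr)) in h2; exact h2.
Qed.

Lemma nondecreasing_derive_nonneg (u : R -> R) (r d : R) :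
  is_derive u r d -> (forall y, r <= y -> u r <= u y) -> 0 <= d.
Proof.
intros hd hmono; apply Rnot_lt_le; intros hneg.
assert (h := is_derive_opp (V := R_NormedModule) u r d hd).
destruct (derive_pos_right (fun x => - u x) r (r + 1) (- d) ltac:(lra) h ltac:(lra))
  as [z [hz H]].
specialize (H z ltac:(lra)); specialize (hmono z ltac:(lra)); lra.
Qed.

(* A bounded nondecreasing solution on the half-line can only converge to a zero of f:
   otherwise u'' stays below a negative constant. *)
Lemma monotone_limit_is_zero (p q s l : R) (f u u1 : R -> R) :
  0 < p -> 0 < q -> ode p q f p_infty u u1 -> (forall r, 0 < r -> 0 <= u r <= s) ->
  (forall x y, 0 < x <= y -> u x <= u y) -> tends_at_end p_infty u l ->
  continuous f l -> 0 <= f l.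
Proof.
intros hp hq h hbd hmono hl hf; apply Rnot_lt_le; intros hneg.
(* Of f l = -3 d, one [d] pays for the variation of f near [l], one for q u / r^2, and one remains
   as the bound on u''. *)
set (d := - f l / 3); assert (hd : 0 < d) by (unfold d; lra).
destruct (proj1 (continuous_eps f l) hf d hd) as [e [he He]].
destruct (hl e he) as [c [[hc _] Hc]].
assert (hs : 0 <= s) by (specialize (hbd 1 ltac:(lra)); lra).
(* Beyond [rho] the values of u are within [e] of [l], and d r^2 >= d rho >= q s because rho >=
   1. *)
set (rho := Rmax (c + 1) (1 + q * s / d)).
assert (h1 : c + 1 <= rho) by apply Rmax_l; assert (h2 : 1 + q * s / d <= rho) by apply Rmax_r.
assert (hqs : 0 <= q * s / d).
{ apply Rmult_le_pos; [nra|left; apply Rinv_0_lt_compat, hd]. }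
assert (hqs' : q * s <= d * rho).
{ apply Rle_trans with (d * (1 + q * s / d)); [|apply Rmult_le_compat_l; lra].
  replace (d * (1 + q * s / d)) with (d + q * s) by (field; lra); lra. }
assert (hu1 : forall r, 0 < r -> 0 <= u1 r).
{ intros r hr; apply (nondecreasing_derive_nonneg u r).
  - apply h; split; [exact hr|easy].
  - intros y hy; apply hmono; lra. }
assert (hacc : forall r, rho <= r -> f (u r) - p / r * u1 r + q / r ^ 2 * u r <= - d).
{ intros r hr.
  assert (hfr := He (u r) (Hc r ltac:(lra) I)); apply Rabs_def2 in hfr.
  assert (hpr : 0 <= p / r * u1 r).
  { apply Rmult_le_pos; [left; apply Rdiv_lt_0_compat; lra|apply hu1; lra]. }
  assert (hqr : q / r ^ 2 * u r <= d).
  { assert (hr2 : 0 < r ^ 2) by (apply pow_lt; lra).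
    apply (Rmult_le_reg_r (r ^ 2)); [exact hr2|].
    replace (q / r ^ 2 * u r * r ^ 2) with (q * u r) by (field; lra).
    specialize (hbd r ltac:(lra)).
    apply Rle_trans with (q * s); [apply Rmult_le_compat_l; lra|].
    apply Rle_trans with (1 := hqs'); apply Rmult_le_compat_l; [lra|nra]. }
  unfold d in *; lra. }
assert (hu1rho := hu1 rho ltac:(lra)).
(* With u'' <= - d from [rho] on, u' would be at most -1 at this point. *)
set (y := rho + (u1 rho + 1) / d).
assert (hy0 : 0 < (u1 rho + 1) / d) by (apply Rdiv_lt_0_compat; lra).
assert (hle : u1 y + d * y <= u1 rho + d * rho).
{ apply (derive_nonpos_le (fun r => u1 r + d * r)
    (fun r => (f (u r) - p / r * u1 r + q / r ^ 2 * u r) + d)); [unfold y; lra| |].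
  - intros r hr; apply (is_derive_plus (V := R_NormedModule)).
    + apply h; split; [lra|easy].
    + auto_derive; [easy|ring].
  - intros r hr; specialize (hacc r ltac:(lra)); lra. }
assert (hy : d * y = d * rho + (u1 rho + 1)) by (unfold y; field; lra).
specialize (hu1 y ltac:(unfold y; lra)); lra.
Qed.

Lemma primitive_neg (f : R -> R) (s : R) : (forall t, continuous f t) -> 0 < s ->
  (forall t, 0 < t < s -> f t < 0) -> RInt f 0 s < 0.
Proof.
intros hf hs hneg.
destruct (mean_value (RInt f 0) f 0 s hs) as [c [hc E]].
{ intros r _; apply is_derive_primitive, hf. }
rewrite RInt_point in E; unfold zero in E; simpl in E.
specialize (hneg c hc); nra.
Qed.

(** * Choice of the shooting amplitude *)

Lemma exists_finite (p q s R0 : R) (F : R -> R) (U U1 : R -> R -> R) :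
  0 < p -> 0 < q -> 0 < s -> 0 < R0 -> (forall t, continuous F t) -> F 0 = 0 -> F s = 0 ->
  (forall c, ode p q (truncated F s) p_infty (U c) (U1 c)) ->
  (forall c, tends_at_zero (U c)) ->
  (forall r, 0 < r -> forall c, continuous (fun c => U c r) c) ->
  U 0 R0 = 0 -> (exists C, 0 < C /\ s < U C R0) ->
  exists u, is_solution R0 s p q F u.
Proof.
intros hp hq hs hR0 hF hF0 hFs hode hzero hcont hU0 [C [hC hUC]].
destruct (first_crossing (fun c => U c R0) 0 C s) as [c [hc [heq _]]]; try lra.
{ intros c _; apply hcont, hR0. }
(* The end value [s] confines the shot to [0, s], where the truncation is invisible. *)
assert (hbd : forall r, dom R0 r -> 0 <= U c r <= s).
{ intros r hr; apply (proj1 (dom_finite _ _)) in hr; split.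
  - apply (truncated_ge_of_ge p q s F (U c) (U1 c) r R0); auto; lra.
  - apply (truncated_le_of_le p q s F (U c) (U1 c) r R0); auto; lra. }
exists (U c); apply (solution_of_ode R0 s p q F (U c) (U1 c)); auto.
- apply (ode_truncated p q s); [|exact hbd].
  apply (ode_restrict p q _ p_infty); [easy|apply hode].
- rewrite <- heq; apply tends_at_end_finite; [exact hR0|].
  apply (ode_continuous p q (truncated F s) p_infty (U c) (U1 c)); [apply hode|split; [exact hR0|easy]].
Qed.

(* The energy gained after r1 is at most q s^2 / (2 r1^2), so a solution that is tiny up to
   a large r1 cannot build up the energy - Phi(s) needed to reach the level s. *)
Lemma small_shots_stay_below (p q s K : R) (F : R -> R) (U U1 : R -> R -> R) :
  0 < p -> 0 < q -> 0 < s -> 0 < K -> lipschitz K (truncated F s) -> F 0 = 0 -> F s = 0 ->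
  (forall t, 0 < t < s -> F t < 0) ->
  (forall c, ode p q (truncated F s) p_infty (U c) (U1 c)) ->
  (forall c, tends_at_zero (U c)) ->
  (forall r, 0 < r -> exists B, 0 < B /\ forall c d,
     Rabs (U c r - U d r) <= B * Rabs (c - d) /\ Rabs (U1 c r - U1 d r) <= B * Rabs (c - d)) ->
  (forall r, 0 < r -> U 0 r = 0 /\ U1 0 r = 0) ->
  exists c0, 0 < c0 /\ forall c r, 0 <= c <= c0 -> 0 < r -> U c r <= s.
Proof.
intros hp hq hs hK hlip hF0 hFs hneg hode hzero hLip hU0.
set (f := truncated F s) in *.
assert (hf := lipschitz_continuous K f hK hlip).
assert (hPhi : RInt f 0 s < 0).
{ apply primitive_neg; auto; intros t ht; unfold f; rewrite truncated_in by lra; auto. }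
set (d := - RInt f 0 s) in *; assert (hd : 0 < d) by (unfold d; lra).
(* Far enough out that the last term of the energy is below d / 2 from here on. *)
set (r1 := 1 + q * s ^ 2 / d).
assert (hs2 : 0 < s ^ 2) by (apply pow_lt, hs).
assert (hqs : 0 < q * s ^ 2 / d) by (apply Rdiv_lt_0_compat; [apply Rmult_lt_0_compat|]; lra).
assert (hr1 : 1 < r1) by (unfold r1; lra).
assert (hr1q : q * s ^ 2 / (2 * r1 ^ 2) < d / 2).
{ assert (hr12 : 0 < r1 ^ 2) by (apply pow_lt; lra).
  apply (Rmult_lt_reg_r (2 * r1 ^ 2)); [lra|].
  replace (q * s ^ 2 / (2 * r1 ^ 2) * (2 * r1 ^ 2)) with (q * s ^ 2) by (field; lra).
  assert (h1 : d * r1 = d + q * s ^ 2) by (unfold r1; field; lra).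
  assert (h2 : d * r1 < d * r1 ^ 2) by (apply Rmult_lt_compat_l; [exact hd|nra]); lra. }
assert (hPhi0 : continuous (RInt f 0) 0).
{ exact (is_derive_continuous _ _ _ (is_derive_primitive f 0 hf)). }
destruct (proj1 (continuous_eps _ 0) hPhi0 (d / 8) ltac:(lra)) as [e [he He]].
rewrite RInt_point in He; unfold zero in He; simpl in He.
destruct (hLip r1 ltac:(lra)) as [B [hB HB]].
(* [e] controls Phi(u), 1 and d / 8 together control u'^2, and [s] keeps the shot below the level at
   [r1]. The energy at [r1] is then below [d], while at a crossing of [s] it is at least [d]. *)
set (eta := Rmin (Rmin e 1) (Rmin (d / 8) s)).
assert (h1 := Rmin_l (Rmin e 1) (Rmin (d / 8) s)); assert (h2 := Rmin_r (Rmin e 1) (Rmin (d / 8) s)).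
assert (h3 := Rmin_l e 1); assert (h4 := Rmin_r e 1).
assert (h5 := Rmin_l (d / 8) s); assert (h6 := Rmin_r (d / 8) s).
fold eta in h1, h2.
assert (heta : 0 < eta) by (unfold eta; repeat apply Rmin_pos; lra).
exists (eta / (2 * B)); split; [apply Rdiv_lt_0_compat; lra|].
intros c r hc hr; apply Rnot_lt_le; intros hlt.
assert (hBc : B * c < eta).
{ assert (h : B * c <= B * (eta / (2 * B))) by (apply Rmult_le_compat_l; lra).
  replace (B * (eta / (2 * B))) with (eta / 2) in h by (field; lra); lra. }
destruct (HB c 0) as [b1 b2]; destruct (hU0 r1 ltac:(lra)) as [z1 z2].
rewrite z1, !Rminus_0_r, (Rabs_pos_eq c) in b1 by lra.
rewrite z2, !Rminus_0_r, (Rabs_pos_eq c) in b2 by lra.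
assert (hr1r : r1 < r).
{ apply Rnot_le_lt; intros hle.
  assert (hle' := truncated_le_of_le p q s F (U c) (U1 c) r r1 hq ltac:(lra) hFs (hode c) (hzero c)).
  apply Rabs_le_between in b1; specialize (hle' ltac:(lra) ltac:(lra)); lra. }
destruct (first_crossing (U c) r1 r s) as [r2 [hr2 [heq hle]]]; try lra.
{ intros x hx; apply (ode_continuous p q f p_infty (U c) (U1 c)); [apply hode|split; [lra|easy]]. }
{ apply Rabs_le_between in b1; lra. }
assert (hE : energy q s f (U c) (U1 c) r2 <= energy q s f (U c) (U1 c) r1).
{ apply (energy_decreasing p q s f p_infty); auto; try lra; [split; [lra|easy]|].
  intros x hx; apply Rabs_le; split; [|apply hle, hx].
  assert (h := truncated_ge_of_ge p q s F (U c) (U1 c) x r2 hq ltac:(lra) hF0 (hode c) (hzero c)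
    ltac:(lra) ltac:(lra)); lra. }
unfold energy in hE; rewrite heq in hE; fold d in hE.
assert (hP := He (U c r1) ltac:(rewrite Rminus_0_r; lra)).
rewrite Rminus_0_r in hP; apply Rabs_def2 in hP.
assert (hU1 : U1 c r1 ^ 2 <= d / 8).
{ rewrite <- pow2_abs; assert (h := Rabs_pos (U1 c r1)); nra. }
assert (hq1 : q * (s ^ 2 - U c r1 ^ 2) / (2 * r1 ^ 2) <= q * s ^ 2 / (2 * r1 ^ 2)).
{ apply Rmult_le_compat_r.
  - left; apply Rinv_0_lt_compat, Rmult_lt_0_compat; [lra|apply pow_lt; lra].
  - apply Rmult_le_compat_l; [lra|]; assert (h := pow2_ge_0 (U c r1)); lra. }
assert (hq2 : q * (s ^ 2 - s ^ 2) / (2 * r2 ^ 2) = 0) by (unfold Rdiv; ring).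
assert (hsq := pow2_ge_0 (U1 c r2)).
unfold d in *; lra.
Qed.

(* The critical shot: the infimum of the initial amplitudes whose solution exceeds s. *)
Lemma exists_infinite (p q s K : R) (F : R -> R) (U U1 : R -> R -> R) :
  0 < p -> 0 < q -> 0 < s -> 0 < K -> lipschitz K (truncated F s) -> F 0 = 0 -> F s = 0 ->
  (forall t, continuous F t) -> (forall t, 0 < t < s -> F t < 0) ->
  (forall c, ode p q (truncated F s) p_infty (U c) (U1 c)) ->
  (forall c, tends_at_zero (U c)) ->
  (forall r, 0 < r -> forall c, continuous (fun c => U c r) c) ->
  (exists c0, 0 < c0 /\ forall c r, 0 <= c <= c0 -> 0 < r -> U c r <= s) ->
  (exists C, 0 < C /\ s < U C 1) ->
  (forall c, 0 < c -> exists x, 0 < x /\ 0 < U c x) ->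
  exists u, is_solution p_infty s p q F u.
Proof.
intros hp hq hs hK hlip hF0 hFs hF hneg hode hzero hcont [c0 [hc0 Hc0]] [C [hC hUC]] hpos.
assert (hf := lipschitz_continuous K _ hK hlip).
set (exceeds := fun c => exists r, 0 < r /\ s < U c r).
(* Asking the same of all smaller amplitudes makes [E] an initial interval, so that its supremum is
   the infimum of the exceeding amplitudes. *)
set (E := fun c => 0 <= c /\ forall d, 0 <= d <= c -> ~ exceeds d).
assert (hEc0 : E c0).
{ split; [lra|]; intros d hd [r [hr hlt]]; specialize (Hc0 d r hd hr); lra. }
destruct (completeness E) as [c [hub hleast]].
{ exists C; intros y [hy Hy]; apply Rnot_lt_le; intros hlt.
  apply (Hy C ltac:(lra)); exists 1; split; [lra|exact hUC]. }
{ exists c0; exact hEc0. }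
assert (hc : 0 < c) by (specialize (hub c0 hEc0); lra).
assert (hlow : forall d, 0 <= d < c -> ~ exceeds d).
{ intros d hd hex; assert (hle : c <= d); [|lra].
  apply hleast; intros y [hy Hy]; apply Rnot_lt_le; intros hlt; apply (Hy d); [lra|exact hex]. }
assert (hle : forall r, 0 < r -> U c r <= s).
{ intros r hr; apply Rnot_lt_le; intros hlt.
  destruct (proj1 (continuous_eps _ c) (hcont r hr c) (U c r - s) ltac:(lra)) as [e [he H]].
  assert (h1 := Rmin_l c (e / 2)); assert (h2 := Rmin_r c (e / 2)).
  assert (h3 : 0 < Rmin c (e / 2)) by (apply Rmin_pos; lra).
  apply (hlow (c - Rmin c (e / 2)) ltac:(lra)); exists r; split; [exact hr|].
  specialize (H (c - Rmin c (e / 2)) ltac:(apply Rabs_def1; lra)); apply Rabs_def2 in H; lra. }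
assert (happrox : forall e, 0 < e -> exists d, Rabs (d - c) < e /\ exceeds d).
{ intros e he; destruct (classic (exists d, c <= d < c + e /\ exceeds d)) as [[d [hd hex]]|hno].
  - exists d; split; [apply Rabs_def1; lra|exact hex].
  - assert (hE : E (c + e / 2)); [|specialize (hub _ hE); lra].
    split; [lra|]; intros d hd hex.
    destruct (Rlt_le_dec d c) as [h|h]; [apply (hlow d); [lra|exact hex]|].
    apply hno; exists d; split; [lra|exact hex]. }
assert (hnear : forall r e, 0 < r -> 0 < e -> exists dl, 0 < dl /\ forall d, Rabs (d - c) < dl ->
  Rabs (U d r - U c r) < e).
{ intros r e hr he; exact (proj1 (continuous_eps _ c) (hcont r hr c) e he). }
assert (hafter : forall d r y, 0 < y -> 0 < r -> U d y <= s -> s < U d r -> y < r).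
{ intros d r y hy hr hyd hrd; apply Rnot_le_lt; intros h.
  assert (h' := truncated_le_of_le p q s F (U d) (U1 d) r y hq ltac:(lra) hFs (hode d) (hzero d)
    hyd ltac:(lra)); lra. }
(* An exceeding shot near [c] passes [s] after r, and up to that passage it is nonnegative; [U c r]
   is a limit of such values. *)
assert (hge : forall r, 0 < r -> 0 <= U c r).
{ intros r hr; apply Rnot_lt_le; intros hlt.
  destruct (hnear r (- U c r) hr ltac:(lra)) as [dl [hdl H]].
  destruct (happrox dl hdl) as [d [hd [y [hy hyd]]]].
  specialize (H d hd); apply Rabs_def2 in H.
  assert (hry := hafter d y r hr hy ltac:(lra) hyd).
  assert (h := truncated_ge_of_ge p q s F (U d) (U1 d) r y hq ltac:(lra) hF0 (hode d) (hzero d)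
    ltac:(lra) ltac:(lra)); lra. }
assert (hcontr : forall d r, 0 < r -> continuous (U d) r).
{ intros d r hr; apply (ode_continuous p q (truncated F s) p_infty (U d) (U1 d));
    [apply hode|split; [exact hr|easy]]. }
(* The critical shot need not reach [s], so monotonicity is taken from nearby exceeding shots: each
   attains [s] at some z > y, and [solution_nondecreasing] applies to it on (0, z). *)
assert (hmono : forall x y, 0 < x <= y -> U c x <= U c y).
{ intros x y hxy; apply Rnot_lt_le; intros hlt.
  destruct (hnear x ((U c x - U c y) / 2) ltac:(lra) ltac:(lra)) as [d1 [hd1 H1]].
  destruct (hnear y ((U c x - U c y) / 2) ltac:(lra) ltac:(lra)) as [d2 [hd2 H2]].
  assert (h1 := Rmin_l d1 d2); assert (h2 := Rmin_r d1 d2).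
  destruct (happrox (Rmin d1 d2)) as [d [hd [r [hr hrd]]]]; [apply Rmin_pos; assumption|].
  specialize (H1 d ltac:(lra)); specialize (H2 d ltac:(lra)).
  apply Rabs_def2 in H1; apply Rabs_def2 in H2.
  assert (hxs := hle x ltac:(lra)).
  assert (hyr := hafter d r y ltac:(lra) hr ltac:(lra) hrd).
  destruct (first_crossing (U d) y r s) as [z [hz [heq _]]]; try lra.
  { intros t ht; apply hcontr; lra. }
  assert (hyz : y < z).
  { destruct hz as [[h|h] _]; [exact h|rewrite <- h in heq; lra]. }
  assert (hm : U d x <= U d y); [|lra].
  apply (solution_nondecreasing p q s (truncated F s) z (U d) (U1 d)); auto.
  - apply (ode_restrict p q _ p_infty); [easy|apply hode].
  - rewrite <- heq; apply tends_at_end_finite; [lra|apply hcontr; lra].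
  - intros t ht; apply (proj1 (dom_finite _ _)) in ht; split.
    + apply (truncated_ge_of_ge p q s F (U d) (U1 d) t z); auto; lra.
    + apply (truncated_le_of_le p q s F (U d) (U1 d) t z); auto; lra.
  - apply dom_finite; lra. }
destruct (completeness (fun t => exists r, 0 < r /\ t = U c r)) as [l [hl1 hl2]].
{ exists s; intros t [r [hr ->]]; apply hle, hr. }
{ exists (U c 1), 1; split; [lra|reflexivity]. }
assert (hlim : tends_at_end p_infty (U c) l).
{ intros e he.
  destruct (classic (exists r, 0 < r /\ l - e < U c r)) as [[r [hr hlt]]|hno].
  - exists r; split; [split; [exact hr|easy]|]; intros y hy _.
    assert (h1 := hmono r y ltac:(lra)).
    assert (h2 := hl1 (U c y) (ex_intro _ y (conj (Rlt_trans _ _ _ hr hy) eq_refl))).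
    apply Rabs_def1; lra.
  - assert (h : l <= l - e); [|lra].
    apply hl2; intros t [r [hr ->]]; apply Rnot_lt_le; intros h; apply hno; exists r; auto. }
(* Excludes the limit 0, which is also a zero of F. *)
destruct (hpos c hc) as [x [hx hUx]].
assert (hlx := hl1 (U c x) (ex_intro _ x (conj hx eq_refl))).
assert (hls : l <= s) by (apply hl2; intros t [r [hr ->]]; apply hle, hr).
assert (hfl := monotone_limit_is_zero p q s l (truncated F s) (U c) (U1 c) hp hq (hode c)
  (fun r hr => conj (hge r hr) (hle r hr)) hmono hlim (hf l)).
rewrite truncated_in in hfl by lra.
assert (hl : l = s).
{ destruct hls as [h|h]; [|exact h]; specialize (hneg l ltac:(lra)); lra. }
rewrite hl in hlim.
exists (U c); apply (solution_of_ode p_infty s p q F (U c) (U1 c)); auto; [easy|].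
apply (ode_truncated p q s); [apply hode|].
intros r [hr _]; split; [apply hge|apply hle]; exact hr.
Qed.

Theorem theorem1p3 (b : Rbar) (sp p q : R) (F : R -> R)
  (hb : Rbar_lt 0 b) (hsp : 0 < sp) (hp : 0 < p) (hq : 0 < q)
  (hF : is_C1 F) (hF0 : F 0 = 0) (hFsp : F sp = 0) (hdF : 0 < Derive F sp)
  (hFneg : forall t, 0 < t < sp -> F t < 0)
  (hFpos : forall t, sp < t -> 0 <= F t)
  (hsm : exists sm : R,
     - sp <= sm < 0 /\
     (forall t, t < sm -> F t <= 0) /\
     (forall t, sm < t < 0 -> 0 <= F t) /\
     (forall t1 t2, 0 < t1 -> t1 <= t2 -> t2 <= Rabs sm ->
        F t1 / t1 + F (- t2) / t2 <= 0)) :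
  exists u : R -> R,
    is_solution b sp p q F u /\
    (forall v : R -> R, is_solution b sp p q F v ->
       forall r : R, 0 < r -> Rbar_lt r b -> v r = u r).
Proof.
assert (hFc : forall t, continuous F t).
{ intros t; apply (ex_derive_continuous F), hF. }
destruct (C1_lipschitz F sp hF (Rlt_le _ _ hsp)) as [K [hK hKl]].
destruct (C1_increasing_near F sp hF hdF) as [eps [heps hinc]].
destruct (positive_indicial_root p q hq) as [al [hal [hroot hm]]].
assert (hex : exists u, is_solution b sp p q F u).
{ assert (hlip := truncated_lipschitz K sp F hK (Rlt_le _ _ hsp) hKl).
  assert (hf0 := truncated_below F sp 0 (Rlt_le _ _ hsp) hF0 (Rle_refl 0)).
  destruct (shooting_family p q al K (truncated F sp) hal hm hroot hK hlip hf0)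
    as [U [U1 [hode [hzero [hLip [hU0 hlarge]]]]]].
  assert (hcont : forall r, 0 < r -> forall c, continuous (fun c => U c r) c).
  { intros r hr c; destruct (hLip r hr) as [B [hB HB]].
    apply (lipschitz_continuous B); [exact hB|].
    intros t t'; apply HB. }
  assert (hreach : forall r, 0 < r -> exists C, 0 < C /\ sp < U C r).
  { intros r hr; destruct (hlarge r hr) as [x [k [hx [hk Hk]]]].
    (* This amplitude gives a value of at least sp + 1 at x < r, and a shot above [sp] at x is still
       above it at r. *)
    assert (hC : 0 < (sp + 1) / k) by (apply Rdiv_lt_0_compat; lra).
    exists ((sp + 1) / k); split; [exact hC|].
    specialize (Hk ((sp + 1) / k) (Rlt_le _ _ hC)).
    replace (k * ((sp + 1) / k)) with (sp + 1) in Hk by (field; lra).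
    apply Rnot_le_lt; intros hle.
    assert (h := truncated_le_of_le p q sp F _ _ x r hq (Rlt_le _ _ hsp) hFsp
      (hode _) (hzero _) hle (conj (proj1 hx) (Rlt_le _ _ (proj2 hx)))); lra. }
  destruct b as [R0| |]; [| |easy].
  - apply (exists_finite p q sp R0 F U U1); auto; apply hU0; exact hb.
  - apply (exists_infinite p q sp K F U U1); auto.
    + apply (small_shots_stay_below p q sp K F U U1); auto.
    + apply hreach; lra.
    + intros c hc; destruct (hlarge 1 Rlt_0_1) as [x [k [hx [hk Hk]]]].
      exists x; split; [lra|]; specialize (Hk c (Rlt_le _ _ hc)); nra. }
assert (hprof : forall v, is_solution b sp p q F v ->
  ode p q F b v (Derive v) /\ monotone_profile b sp v).
{ intros v hv; assert (hode := ode_of_solution b sp p q F v hv).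
  destruct hv as [_ [_ [hv0 hvs]]].
  apply tends_at_zero_filterlim in hv0; apply (tends_at_end_filterlim b v sp hb) in hvs.
  split; [exact hode|].
  destruct hsm as [sm [hsm1 [hsm2 [_ hsm4]]]].
  assert (hge : forall r, dom b r -> 0 <= v r).
  { apply (solution_nonneg p q sp sm F b v (Derive v)); auto.
    intros t ht; specialize (hsm4 t t ltac:(lra) ltac:(lra)).
    rewrite (Rabs_left sm) in hsm4 by lra; specialize (hsm4 ltac:(lra)).
    assert (h : (F t + F (- t)) / t <= 0) by (unfold Rdiv in *; lra).
    apply (Rmult_le_compat_r t) in h; [|lra].
    replace ((F t + F (- t)) / t * t) with (F t + F (- t)) in h by (field; lra); lra. }
  assert (hle : forall r, dom b r -> v r <= sp).
  { apply (maximum_principle p q F b v (Derive v) sp sp); auto; lra. }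
  assert (hbd : forall r, dom b r -> 0 <= v r <= sp) by (intros r hr; split; auto).
  split; [|split; [|split; [exact hv0|exact hvs]]].
  - intros r hr; split.
    + apply (solution_pos p q sp al F b v (Derive v)); auto.
      intros t ht; destruct (Req_dec t 0) as [-> |h0]; [lra|].
      destruct (Req_dec t sp) as [-> |h1]; [lra|].
      left; apply hFneg; lra.
    + apply (solution_lt p q sp F b v (Derive v)); auto.
  - intros x y hxy hy.
    apply (solution_nondecreasing p q sp F b v (Derive v)); auto. }
destruct hex as [u hu]; exists u; split; [exact hu|].
intros v hv r hr hrb.
destruct (hprof u hu) as [hu1 hu2]; destruct (hprof v hv) as [hv1 hv2].
apply Rle_antisym.
- apply (comparison p q sp K eps F b u (Derive u) v (Derive v)); auto; split; assumption.
- apply (comparison p q sp K eps F b v (Derive v) u (Derive u)); auto; split; assumption.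
Qed.
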